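(* For every real $p\ge 1$ there exists a constant $c_p$ such that $$V_2\big(K+_p(-K)\big)\le c_p\,V_2(K)$$ for all convex bodies $K\subset\mathbb{R}^2$ containing the origin; moreover, if $K$ is a triangle with one vertex at the origin, then equality holds in this inequality (with the same constant $c_p$).
   Context: A convex body in $\mathbb{R}^n$ is a non-empty compact convex subset of $\mathbb{R}^n$; its support function is $h_K(u)=\sup\{\langle x,u\rangle : x\in K\}$, $u\in\mathbb{R}^n$. For a real number $p\ge 1$ and convex bodies $K,L\subset\mathbb{R}^n$ both containing the origin, the $p$-sum $K+_pL$ is the convex body whose support function is $h_{K+_pL}(u)=\big(h_K(u)^p+h_L(u)^p\big)^{1/p}$, $u\in\mathbb{R}^n$. Here $-K=\{-x: x\in K\}$, and $V_2$ denotes area (two-dimensional Lebesgue measure). Triangles are non-degenerate. *)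

(* Defs.v *)
From HB Require Import structures.
From mathcomp Require Import all_boot all_order all_algebra.
From mathcomp Require Import all_classical all_reals all_analysis.

Set Implicit Arguments.
Unset Strict Implicit.
Unset Printing Implicit Defensive.

Import Order.TTheory GRing.Theory Num.Theory.
Import numFieldNormedType.Exports.

Local Open Scope classical_set_scope.
Local Open Scope ring_scope.

(* The Euclidean plane is [R * R], with its product topology, module structure
   and product sigma-algebra. *)

Definition dot (R : realType) (x u : R * R) : R := x.1 * u.1 + x.2 * u.2.

Definition convex_body (R : realType) (K : set (R * R)) : Prop :=
  [/\ K !=set0, compact K & convex_set K].

Definition support_fun (R : realType) (K : set (R * R)) (u : R * R) : R :=
  sup [set dot x u | x in K].

Definition reflection (R : realType) (K : set (R * R)) : set (R * R) :=
  [set - x | x in K].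

(* When p >= 1 and K, L are convex bodies containing the origin, the right-hand
   side below is a sublinear function of u, so exactly one such body M exists;
   the default value [set0] is only reached outside that situation. *)
Definition psum (R : realType) (p : R) (K L : set (R * R)) : set (R * R) :=
  xget set0 [set M | convex_body M /\
    forall u, support_fun M u
              = (support_fun K u `^ p + support_fun L u `^ p) `^ p^-1].

Definition area (R : realType) (A : set (R * R)) : \bar R :=
  (lebesgue_measure \x lebesgue_measure)%E A.

Definition affinely_independent3 (R : realType) (a b c : R * R) : Prop :=
  forall s t : R, s *: (b - a) + t *: (c - a) = 0 -> s = 0 /\ t = 0.

Definition triangle (R : realType) (a b c : R * R) : set (R * R) :=
  [set x | exists r s t : R,
    [/\ 0 <= r, 0 <= s, 0 <= t, r + s + t = 1
      & x = r *: a + s *: b + t *: c]].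

Definition triangle_at_origin (R : realType) (K : set (R * R)) : Prop :=
  exists a b : R * R, affinely_independent3 0 a b /\ K = triangle 0 a b.

(* Main.v *)
(* Let [B] be the nonnegative part of the unit ball dual to the l_p norm. The
   body [K +_p (-K)] is the union [N(K)] of the sets [aK - bK] over [(a, b)] in
   [B], which makes sense for every [p >= 1] and depends monotonically and
   linearly-equivariantly on [K].

   If the points of a convex body move with constant speeds parallel to a fixed
   direction, then so do the points of [N(K)], and slicing by lines in that
   direction shows that the area of [N(K)] is a convex function of time
   (a shadow-system argument). It is used twice.
   - Translations: [w |-> area N(K - w)] is convex on [K], so for a polygon the
     origin may be moved to a vertex.
   - Vertex sliding: in a polygon with vertices [0, v1, ..., vm], slide [v2]
     parallel to [v3 - v1]. The area of the polygon stays constant, and at either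
     end of the slide a vertex becomes redundant. By induction on [m] the polygon
     is reduced to a triangle with a vertex at the origin.
   All such triangles are linearly equivalent, hence share one ratio
   [c = area N(T) / area T]. General bodies are approximated by polygons
   [P] inside [K] with [N(K)] contained in [(1 + eps) N(P)]. *)
Require Import Defs.
From HB Require Import structures.
From mathcomp Require Import all_boot all_order all_algebra.
From mathcomp Require Import all_classical all_reals all_analysis.
From mathcomp Require Import measurable_realfun ring lra.
Import Order.TTheory GRing.Theory Num.Theory.
Import numFieldNormedType.Exports.
Local Open Scope classical_set_scope.
Local Open Scope ring_scope.

Set Implicit Arguments.
Unset Strict Implicit.
Unset Printing Implicit Defensive.

(** * Lebesgue measure of plane sets *)

Section PlaneMeasure.
Variable R : realType.
Implicit Types A B : set (R * R).

(** An open set is a countable union of boxes with rational centres and radii [1 / (n + 1)], and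
    each box is a measurable product. *)
Lemma open_measurable_plane A : open A -> measurable A.
Proof.
move=> oA.
pose F (i : rat * rat * nat) : set (R * R) :=
  let Q := ball (ratr i.1.1 : R) (i.2.+1%:R^-1) `*` ball (ratr i.1.2 : R) (i.2.+1%:R^-1) in
  if `[< Q `<=` A >] then Q else set0.
have -> : A = \bigcup_i F i.
  apply/seteqP; split => [[x y] Axy|[x y] [[[q r] n] _]]; last first.
    by rewrite /F; case: asboolP => // QA; exact: QA.
  have [e /= e0 eA] : nbhs_ball (x, y) A by rewrite nbhs_ballE; exact: open_nbhs_nbhs.
  have [n ne] : exists n : nat, n.+1%:R^-1 < e / 2.
    have e20 : 0 < e / 2 by rewrite divr_gt0.
    exists (Num.truncn (e / 2)^-1); rewrite invf_plt ?posrE//.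
    exact: Num.Theory.truncnS_gt.
  have [q qx] : exists q : rat, `|x - ratr q| < n.+1%:R^-1.
    have /rat_in_itvoo[q] : x - n.+1%:R^-1 < x + n.+1%:R^-1.
      by rewrite ltrD2l gt0_cp// invr_gt0.
    by rewrite in_itv/= => /andP[q1 q2]; exists q; rewrite ltr_distlC q1 q2.
  have [r ry] : exists q : rat, `|y - ratr q| < n.+1%:R^-1.
    have /rat_in_itvoo[r] : y - n.+1%:R^-1 < y + n.+1%:R^-1.
      by rewrite ltrD2l gt0_cp// invr_gt0.
    by rewrite in_itv/= => /andP[q1 q2]; exists r; rewrite ltr_distlC q1 q2.
  exists (q, r, n) => //; rewrite /F/=; case: asboolP => [_|].
    by rewrite -!ball_normE /ball_/=; split; rewrite /= distrC.
  move=> QA; exfalso; apply: QA => -[x' y'] []/=; rewrite -!ball_normE/= => x'q y'r.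
  apply: eA; split; rewrite /= -ball_normE/=.
    by rewrite (splitr e); apply: le_lt_trans (ler_distD (ratr q) x x') (ltrD (lt_trans qx ne) (lt_trans x'q ne)).
  by rewrite (splitr e); apply: le_lt_trans (ler_distD (ratr r) y y') (ltrD (lt_trans ry ne) (lt_trans y'r ne)).
apply: countable_bigcupT_measurable => [|[[q r] n]]; [exact: countableP|rewrite /F; case: ifPn => _ //].
by apply: measurableX; apply: measurable_ball.
Qed.

Lemma compact_measurable_plane A : compact A -> measurable A.
Proof.
move=> cA; rewrite -[A]setCK; apply: measurableC; apply: open_measurable_plane.
by apply: closed_openC; apply: compact_closed => //; exact: norm_hausdorff.
Qed.

Lemma area_ge0 A : (0 <= area A)%E.
Proof. exact: measure_ge0. Qed.

Lemma le_area A B : measurable A -> measurable B -> A `<=` B -> (area A <= area B)%E.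
Proof. by move=> mA mB AB; apply: le_measure; rewrite ?inE. Qed.

Lemma areaU A B : measurable A -> measurable B -> A `&` B = set0 ->
  area (A `|` B) = (area A + area B)%E.
Proof. by move=> mA mB AB; apply: measureU. Qed.

Lemma areaDI A B : measurable A -> measurable B ->
  area A = (area (A `\` B) + area (A `&` B))%E.
Proof. by move=> mA mB; apply: measureDI. Qed.

(** The left side is a measure in [X] that agrees with length on half-open intervals, so uniqueness
    of Lebesgue measure applies. For [k < 0] the preimage is half-open on the other side, which does
    not change its length. *)
Lemma lebesgue_measure_affine_preimage (k e : R) (X : set R) : k != 0 ->
  measurable X ->
  (`|k|%:E * lebesgue_measure ((fun y => (k * y + e)%R) @^-1` X))%E = lebesgue_measure X.
Proof.
move=> k0 mX.
have mf : measurable_fun [set: R] (fun y : R => (k * y + e)%R : measurableTypeR R).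
  by apply: measurable_funD => //; apply: measurable_funM.
pose m := mscale (NngNum (normr_ge0 k)) (pushforward lebesgue_measure (fun y : R => (k * y + e)%R : measurableTypeR R)).
transitivity (m mf X) => //; apply/esym; apply: lebesgue_measure_unique => // _ [[a b] _ <-].
rewrite /m/= /mscale/= /pushforward.
have [kgt|klt|/eqP] := ltgtP k 0; last by rewrite (negbTE k0).
- rewrite (_ : _ @^-1` _ = [set` `[(b - e) / k, (a - e) / k[ ]).
    rewrite !lebesgue_measure_itv/= !lte_fin ltr_nM2r ?invr_lt0//.
    rewrite ltrD2r; case: ifPn => ab; last by rewrite mule0.
    by rewrite ltr0_norm// -!EFinB -EFinM; congr EFin; field.
  apply/seteqP; split => y/=; rewrite !in_itv/= ler_ndivrMr// ltr_ndivlMr//; lra.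
- rewrite (_ : _ @^-1` _ = [set` `](a - e) / k, (b - e) / k] ]).
    rewrite !lebesgue_measure_itv/= !lte_fin ltr_pM2r ?invr_gt0//.
    rewrite ltrD2r; case: ifPn => ab; last by rewrite mule0.
    by rewrite gtr0_norm// -!EFinB -EFinM; congr EFin; field.
  apply/seteqP; split => y/=; rewrite !in_itv/= ler_pdivlMr// ltr_pdivrMr//; lra.
Qed.

(** By Fubini: on each vertical line the map is affine in one variable, with slope [k]. *)
Lemma area_shear (c k e : R) A : k != 0 -> measurable A ->
  (`|k|%:E * area ((fun x : R * R => (x.1, c * x.1 + k * x.2 + e)%R) @^-1` A))%E = area A.
Proof.
move=> k0 mA; set f := fun x => _.
have mf : measurable_fun setT f.
  by apply: measurable_fun_pair => //; do ![apply: measurable_funD => //|apply: measurable_funM => //].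
have mfA : measurable (f @^-1` A) by rewrite -[X in measurable X]setTI; exact: mf.
rewrite /area /product_measure1 -ge0_integralZl//=; last first.
  exact: measurable_fun_xsection.
apply: eq_integral => x _; rewrite /= -(@lebesgue_measure_affine_preimage k (c * x + e) (xsection A x))//; last first.
  exact: measurable_xsection.
congr (_ * lebesgue_measure _)%E; apply/seteqP; split => y; rewrite /xsection /= !inE /f /=;
  by rewrite (_ : c * x + k * y + e = k * y + (c * x + e))//; ring.
Qed.

Lemma area_swap A : measurable A -> area ((fun x : R * R => (x.2, x.1)) @^-1` A) = area A.
Proof.
move=> mA.
have ms : measurable_fun setT (fun x : measurableTypeR R * measurableTypeR R =>
    (x.2, x.1) : measurableTypeR R * measurableTypeR R).
  exact: measurable_fun_pair.
pose m : {measure set (measurableTypeR R * measurableTypeR R) -> \bar R} := pushforward (lebesgue_measure \x lebesgue_measure)%E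
  ((fun x => (x.2, x.1)) : measurableTypeR R * measurableTypeR R -> measurableTypeR R * measurableTypeR R).
rewrite /area [RHS](@product_measure_unique _ _ _ _ _ _ _ (m ms))//.
move=> X Y mX mY; rewrite /m/= /pushforward.
rewrite (_ : _ @^-1` _ = Y `*` X); first by rewrite product_measure1E// muleC.
by apply/seteqP; split => -[a b] [].
Qed.
End PlaneMeasure.

(** * Affine maps of the plane *)

Section AffineMaps.
Variable R : realType.
Implicit Types (A B : set (R * R)) (a b w x y z d : R * R).

Lemma scale_pairE (k : R) x : k *: x = (k * x.1, k * x.2).
Proof. by []. Qed.

Lemma eq_planeP x y : x.1 = y.1 -> x.2 = y.2 -> x = y.
Proof. by case: x y => [? ?] [? ?] /= -> ->. Qed.

Definition cross x y : R := x.1 * y.2 - x.2 * y.1.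

Definition aff a b w x : R * R := x.1 *: a + x.2 *: b + w.

Lemma affE a b w x : aff a b w x =
  (a.1 * x.1 + b.1 * x.2 + w.1, a.2 * x.1 + b.2 * x.2 + w.2).
Proof. by rewrite /aff; congr (_, _) => /=; rewrite ![_ *: _]mulrC. Qed.

Lemma convex_setP A : convex_set A <->
  forall x y t, 0 <= t -> t <= 1 -> A x -> A y -> A (t *: x + (1 - t) *: y).
Proof.
split=> [cA x y t t0 t1 Ax Ay|cA x y l]; last first.
  by rewrite !inE => Ax Ay; apply: cA.
have /andP tI : (0 <= t) && (t <= 1) by rewrite t0 t1.
have := cA x y (@Itv01 R t t0 t1).
by rewrite !inE /conv/= => /(_ Ax Ay).
Qed.

Lemma continuous_fst_plane : continuous (fun x : R * R => x.1).
Proof. by move=> x; exact: cvg_fst. Qed.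

Lemma continuous_snd_plane : continuous (fun x : R * R => x.2).
Proof. by move=> x; exact: cvg_snd. Qed.

Lemma continuous_pair_plane (f g : R * R -> R) :
  continuous f -> continuous g -> continuous (fun x => (f x, g x)).
Proof. by move=> cf cg x; exact: cvg_pair (cf x) (cg x). Qed.

Lemma continuous_affine_form (p q e : R) :
  continuous (fun x : R * R => p * x.1 + q * x.2 + e).
Proof.
move=> x; apply: cvgD; last exact: cvg_cst.
by apply: cvgD; (apply: cvgM; first exact: cvg_cst); [exact: cvg_fst|exact: cvg_snd].
Qed.

Lemma continuous_aff a b w : continuous (aff a b w).
Proof.
rewrite (_ : aff a b w = fun x => (a.1 * x.1 + b.1 * x.2 + w.1, a.2 * x.1 + b.2 * x.2 + w.2)).
  by apply: continuous_pair_plane; exact: continuous_affine_form.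
by apply/funext => x; exact: affE.
Qed.

Definition aff_inv a b w x : R * R :=
  (cross (x - w) b / cross a b, cross a (x - w) / cross a b).

Lemma aff_invK a b w : cross a b != 0 -> cancel (aff_inv a b w) (aff a b w).
Proof.
rewrite /cross => D0 x; rewrite affE /aff_inv /cross/=.
by rewrite [RHS]surjective_pairing; congr (_, _); field.
Qed.

Lemma affK a b w : cross a b != 0 -> cancel (aff a b w) (aff_inv a b w).
Proof.
rewrite /cross => D0 x; rewrite affE /aff_inv /cross/=.
by rewrite [RHS]surjective_pairing; congr (_, _); field.
Qed.

Lemma aff_preimageE a b w A : cross a b != 0 -> aff a b w @^-1` A = aff_inv a b w @` A.
Proof.
move=> D0; apply/seteqP; split=> [x Ax|_ [x Ax <-]].
  by exists (aff a b w x) => //; rewrite affK.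
by rewrite /preimage/= aff_invK.
Qed.

Lemma continuous_image_compact (f : R * R -> R * R) A :
  continuous f -> compact A -> compact (f @` A).
Proof. by move=> cf cA; apply: continuous_compact => //; exact: continuous_subspaceT. Qed.

Lemma compact_aff_preimage a b w A : cross a b != 0 -> compact A ->
  compact (aff a b w @^-1` A).
Proof.
move=> D0 cA; rewrite aff_preimageE//; apply: continuous_image_compact => //.
rewrite (_ : aff_inv a b w = fun x => ((b.2 / cross a b) * x.1 + (- b.1 / cross a b) * x.2
    + (- (cross w b) / cross a b),
  (- a.2 / cross a b) * x.1 + (a.1 / cross a b) * x.2 + (- (cross a w) / cross a b))).
  by apply: continuous_pair_plane; exact: continuous_affine_form.
by apply/funext => x; rewrite /aff_inv; congr (_, _); rewrite /cross/=; field.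
Qed.

Lemma area_aff_preimage a b w A : cross a b != 0 -> measurable A ->
  (`|cross a b|%:E * area (aff a b w @^-1` A))%E = area A.
Proof.
move=> D0.
(* If [q] is nonzero, the map is a shear, then the coordinate swap, then the second shear [T]; the
   slopes of the two shears multiply to minus the determinant. *)
have area_form (p q e r s g : R) (B : set (R * R)) : q != 0 -> p * s - q * r != 0 -> measurable B ->
  (`|p * s - q * r|%:E * area ((fun x : R * R => (p * x.1 + q * x.2 + e, r * x.1 + s * x.2 + g)%R) @^-1` B))%E = area B.
  move=> q0 E0 mB.
  have k0 : (p * s - q * r) / - q != 0 by rewrite mulf_neq0// invr_neq0// oppr_eq0.
  pose T := fun x : R * R => (x.1, s / q * x.1 + (p * s - q * r) / - q * x.2 + (g - s * e / q)).
  have mT : measurable (T @^-1` B).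
    rewrite -[X in measurable X]setTI.
    have mT : measurable_fun setT T.
      by apply: measurable_fun_pair => //; do ![apply: measurable_funD => //|apply: measurable_funM => //].
    exact: mT.
  have mT2 : measurable ((fun x : R * R => (x.2, x.1)) @^-1` (T @^-1` B)).
    rewrite -[X in measurable X]setTI.
    have ms : measurable_fun setT (fun x : R * R => (x.2, x.1)).
      exact: measurable_fun_pair.
    exact: ms.
  rewrite -(@area_shear R (s / q) _ (g - s * e / q) B k0 mB) -/T -(area_swap mT).
  rewrite -(@area_shear R p _ e _ q0 mT2) muleA -EFinM.
  congr (_%:E * area _)%E; first by rewrite -normrM -[LHS]normrN; congr `|_|; field.
  apply/seteqP; split=> x; rewrite /preimage/= /T/=;
  rewrite (_ : s / q * (p * x.1 + q * x.2 + e) + (p * s - q * r) / - q * x.1 + (g - s * e / q)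
             = r * x.1 + s * x.2 + g)//; by field.
move=> mA.
rewrite (_ : aff a b w = fun x => (a.1 * x.1 + b.1 * x.2 + w.1, a.2 * x.1 + b.2 * x.2 + w.2)); last first.
  by apply/funext => x; exact: affE.
have [b0|b0] := eqVneq b.1 0; last first.
  rewrite -[RHS](@area_form a.1 b.1 w.1 a.2 b.2 w.2)//; last by move: D0; rewrite /cross (mulrC a.2).
  by rewrite /cross (mulrC a.2).
have a0 : a.1 != 0 by move: D0; apply: contra_neq; rewrite /cross b0 => ->; ring.
(* Here [b.1 = 0]; exchanging the two variables puts the nonzero entry [a.1] in the place of [q]. *)
rewrite -[in LHS]area_swap; last first.
  rewrite -[X in measurable X]setTI.
  have ms : measurable_fun setT (fun x : R * R => (a.1 * x.1 + b.1 * x.2 + w.1, a.2 * x.1 + b.2 * x.2 + w.2)).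
    by apply: measurable_fun_pair => //; do ![apply: measurable_funD => //|apply: measurable_funM => //].
  exact: ms.
rewrite -[RHS](@area_form b.1 a.1 w.1 b.2 a.2 w.2)//; last first.
  by rewrite b0 mul0r sub0r oppr_eq0; move: D0; rewrite /cross b0 mulr0 subr0.
congr (_%:E * area _)%E; first by rewrite -normrN /cross; congr `|_|; ring.
by apply/seteqP; split=> x; rewrite /preimage/= (addrC (a.1 * _)) (addrC (a.2 * _)).
Qed.

Lemma area_aff_image a b w A : cross a b != 0 -> compact A ->
  area (aff a b w @` A) = (`|cross a b|%:E * area A)%E.
Proof.
move=> D0 cA; rewrite -(@area_aff_preimage a b w (aff a b w @` A))//.
  congr (_ * area _)%E; apply/seteqP; split=> x; first by move=> [y Ay] /(can_inj (affK w D0)) <-.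
  by move=> Ax; exists x.
by apply: compact_measurable_plane; apply: continuous_image_compact => //; exact: continuous_aff.
Qed.

Lemma area_translate w A : compact A -> area ((fun x => x + w) @` A) = area A.
Proof.
move=> cA; have D : cross (1, 0) (0, 1) = 1 :> R by rewrite /cross/=; ring.
rewrite (_ : (fun x => x + w) = aff (1, 0) (0, 1) w).
  by rewrite area_aff_image// D ?oner_neq0// normr1 mul1e.
apply/funext => x; rewrite affE [LHS]surjective_pairing; congr (_, _) => /=; ring.
Qed.

Lemma area_scale (k : R) A : 0 < k -> compact A ->
  area ((fun x => k *: x) @` A) = ((k ^+ 2)%:E * area A)%E.
Proof.
move=> k0 cA; have D : cross (k, 0) (0, k) = k ^+ 2 by rewrite /cross/=; ring.
rewrite (_ : (fun x => k *: x) = aff (k, 0) (0, k) 0).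
  by rewrite area_aff_image// D ?ger0_norm ?sqr_ge0// expf_neq0// gt_eqF.
apply/funext => x; rewrite affE [LHS]surjective_pairing; congr (_, _) => /=; rewrite /GRing.scale/=; ring.
Qed.

(** The value is the squared norm of [d]: a nonzero vector and its quarter turn form a basis, in
    which lines parallel to [d] become vertical. *)
Lemma cross_neq0 d : d != 0 -> cross (d.2, - d.1) d != 0.
Proof.
move=> d0; rewrite /cross/=; apply: contra_neq d0 => d0.
have /eqP : d.1 ^+ 2 + d.2 ^+ 2 = 0 by rewrite -d0; ring.
rewrite paddr_eq0 ?sqr_ge0// !sqrf_eq0 => /andP[/eqP d1 /eqP d2].
by rewrite [d]surjective_pairing d1 d2.
Qed.

Lemma closed_line d : closed [set x | cross d x = 0].
Proof.
have cc : continuous (cross d).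
  rewrite (_ : cross d = fun x => - d.2 * x.1 + d.1 * x.2 + 0); first exact: continuous_affine_form.
  by apply/funext => x; rewrite /cross; ring.
have := @closed_comp _ _ (cross d) [set (0 : R)] (fun x _ => cc x).
by apply; exact: closed_eq.
Qed.

Lemma measurable_line d : measurable [set x | cross d x = 0].
Proof.
rewrite -[X in measurable X]setCK; apply: measurableC; apply: open_measurable_plane.
exact: closed_openC (@closed_line d).
Qed.

Lemma area_line d : d != 0 -> area [set x | cross d x = 0] = 0%E.
Proof.
move=> d0; have D := cross_neq0 d0.
rewrite -(@area_aff_preimage _ _ 0 _ D); last exact: measurable_line.
rewrite (_ : _ @^-1` _ = [set (0 : R)] `*` setT).
  by rewrite /area product_measure1E//= lebesgue_measure_set1 mul0e mule0.
apply/seteqP; split => x; rewrite /preimage/= affE /cross/=.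
  rewrite (_ : _ - _ = - cross (d.2, - d.1) d * x.1); last by rewrite /cross/=; ring.
  by move=> /eqP; rewrite mulf_eq0 oppr_eq0 (negbTE D)/= => /eqP.
by move=> [-> _]; ring.
Qed.

Lemma measurable_box (a b : R) : measurable (`[a, b]%classic `*` `[a, b]%classic).
Proof. exact: measurableX. Qed.

Lemma compact_in_box A : compact A ->
  exists2 M : R, 0 < M & A `<=` `[- M, M]%classic `*` `[- M, M]%classic.
Proof.
move=> /compact_bounded[M [_ AM]].
exists (Num.max M 0 + 1); first by rewrite ltr_wpDl// le_max lexx orbT.
move=> x Ax; have := AM (Num.max M 0 + 1).
have -> : M < Num.max M 0 + 1 by rewrite (@le_lt_trans _ _ (Num.max M 0)) ?le_max ?lexx// ltrDl.
move=> /(_ isT x Ax); rewrite /= prod_normE ge_max => /andP[x1 x2].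
by split; rewrite /= in_itv/= -ler_norml.
Qed.

Lemma area_compact_lty A : compact A -> (area A < +oo)%E.
Proof.
move=> cA; have [M M0 AM] := compact_in_box cA.
apply: (@le_lt_trans _ _ (area ((`[- M, M]%classic `*` `[- M, M]%classic)%R : set (R * R)))).
  by apply: le_area => //; [exact: compact_measurable_plane|exact: measurable_box].
rewrite /area product_measure1E//= !lebesgue_measure_itv/=.
by case: ifPn => _; rewrite ?mule0// -EFinB -EFinM ltry.
Qed.

Lemma area_compact_fin_num A : compact A -> area A \is a fin_num.
Proof. by move=> cA; rewrite ge0_fin_numE ?area_ge0//; exact: area_compact_lty. Qed.

End AffineMaps.

(** * Slicing by parallel lines *)

Section Slicing.
Variable R : realType.
Implicit Types (N A : set (R * R)) (d : R * R).

(** For [b < a] the bound is trivial. This case matters because the slicing argument applies the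
    lemma to two points of a slice whose order is not known. *)
Lemma lebesgue_measure_ge_segment (X : set R) (a b : R) : measurable X ->
  (forall y, a <= y <= b -> X y) -> ((b - a)%:E <= lebesgue_measure X)%E.
Proof.
move=> mX abX; have [ab|ba] := leP a b; last first.
  by apply: (@le_trans _ _ 0%E) => //; rewrite lee_fin subr_le0 ltW.
have <- : lebesgue_measure (`[a, b]%classic : set R) = (b - a)%:E.
  rewrite lebesgue_measure_itv/= lte_fin; case: ltP => // ba.
  by rewrite (@le_anti _ _ a b) ?ab// subrr.
by apply: le_measure; rewrite ?inE//= => y /=; rewrite in_itv/=; exact: abX.
Qed.

Lemma lebesgue_measure_le_segment (X : set R) (a b : R) : measurable X -> a <= b ->
  (forall y, X y -> a <= y <= b) -> (lebesgue_measure X <= (b - a)%:E)%E.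
Proof.
move=> mX ab abX.
have <- : lebesgue_measure (`[a, b]%classic : set R) = (b - a)%:E.
  rewrite lebesgue_measure_itv/= lte_fin; case: ltP => // ba.
  by rewrite (@le_anti _ _ a b) ?ab// subrr.
by apply: le_measure; rewrite ?inE//= => y /= Xy; rewrite in_itv/=; exact: abX.
Qed.

Lemma convex_xsection A x1 (y1 y2 y : R) : convex_set A ->
  A (x1, y1) -> A (x1, y2) -> y1 <= y <= y2 -> A (x1, y).
Proof.
move=> /convex_setP cA A1 A2 /andP[y1y yy2].
have [e|ne] := eqVneq y1 y2.
  by rewrite (_ : y = y1)//; apply/eqP; rewrite eq_le y1y e yy2.
have y12 : 0 < y2 - y1.
  by rewrite subr_gt0 lt_neqAle ne (le_trans y1y yy2).
rewrite (_ : (x1, y) = ((y2 - y) / (y2 - y1)) *: (x1, y1) + (1 - (y2 - y) / (y2 - y1)) *: (x1, y2)).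
  apply: cA => //; first by rewrite divr_ge0 ?subr_ge0 // (le_trans y1y).
  by rewrite ler_pdivrMr// mul1r lerB.
have y120 : y2 - y1 != 0 by rewrite gt_eqF.
by apply: eq_planeP; rewrite !scale_pairE /=; field.
Qed.

(* Along each vertical line the endpoints of the slices of [N1] and [N2]
   interpolate linearly to those of the slice of [N]. *)
Lemma area_le_vertical_interpolation N N1 N2 (s : R) : 0 <= s -> s <= 1 ->
  compact N -> compact N1 -> compact N2 -> convex_set N1 -> convex_set N2 ->
  (forall z, N z -> exists r : R, N1 (z.1, z.2 - s * r) /\ N2 (z.1, z.2 + (1 - s) * r)) ->
  (area N <= (1 - s)%:E * area N1 + s%:E * area N2)%E.
Proof.
move=> s0 s1 cN cN1 cN2 vN1 vN2 NN.
have os0 : 0 <= 1 - s by rewrite subr_ge0.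
have mN := compact_measurable_plane cN.
have mN1 := compact_measurable_plane cN1.
have mN2 := compact_measurable_plane cN2.
rewrite /area /product_measure1 -!ge0_integralZl//=; try exact: measurable_fun_xsection.
rewrite -ge0_integralD//=; first last.
- by apply: emeasurable_funM => //; exact: measurable_fun_xsection.
- by move=> x _; rewrite mule_ge0.
- by apply: emeasurable_funM => //; exact: measurable_fun_xsection.
- by move=> x _; rewrite mule_ge0.
apply: ge0_le_integral => //=.
- exact: measurable_fun_xsection.
- by apply: emeasurable_funD; apply: emeasurable_funM => //; exact: measurable_fun_xsection.
move=> x _.
have [N0|/set0P/negP] := pselect ((N `&` [set z | z.1 = x]) !=set0); last first.
  rewrite negbK => /eqP N0; rewrite (_ : xsection N x = set0).
    by rewrite measure0 adde_ge0// mule_ge0.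
  apply/seteqP; split=> // y; rewrite /xsection/= inE => Nxy.
  by have : (N `&` [set z | z.1 = x]) (x, y) by []; rewrite N0.
have cNx : compact (N `&` [set z | z.1 = x]).
  apply: compact_closedI => //.
  have := @closed_comp _ _ (fun z : R * R => z.1) [set x] (fun z _ => @continuous_fst_plane R z).
  by apply; exact: closed_eq.
have c2 : {within N `&` [set z | z.1 = x], continuous (fun z : R * R => z.2)}.
  by apply: continuous_subspaceT; exact: continuous_snd_plane.
have [[x1 t]] := compact_EVT_max N0 cNx c2; rewrite inE /= => -[Nt x1x] tmax.
have [[x2 b]] := compact_EVT_min N0 cNx c2; rewrite inE /= => -[Nb x2x] bmin.
subst x1 x2.
have Nbt y : xsection N x y -> b <= y <= t.
  rewrite /xsection/= inE => Nxy; have xy : (x, y) \in N `&` [set z | z.1 = x] by rewrite inE.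
  by rewrite (bmin _ xy) (tmax _ xy).
have [r [/= N1t N2t]] := NN _ Nt; have [q [/= N1b N2b]] := NN _ Nb.
have bt : b <= t by have /andP[] : b <= t <= t by apply: Nbt; rewrite /xsection/= inE.
apply: (le_trans (lebesgue_measure_le_segment _ bt Nbt)); first exact: measurable_xsection.
(* The displaced end points lie in [N1], so by convexity its slice contains the segment between
   them; likewise for [N2]. *)
have L1 : (((t - s * r) - (b - s * q))%:E <= lebesgue_measure (xsection N1 x))%E.
  apply: lebesgue_measure_ge_segment; first exact: measurable_xsection.
  by move=> y ybt; rewrite /xsection/= inE; exact: convex_xsection vN1 N1b N1t ybt.
have L2 : (((t + (1 - s) * r) - (b + (1 - s) * q))%:E <= lebesgue_measure (xsection N2 x))%E.
  apply: lebesgue_measure_ge_segment; first exact: measurable_xsection.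
  by move=> y ybt; rewrite /xsection/= inE; exact: convex_xsection vN2 N2b N2t ybt.
(* The displacements [r] and [q] cancel in the weighted mean, so the length of the slice of [N] is
   at most the mean of the two lower bounds. *)
rewrite (_ : t - b = (1 - s) * ((t - s * r) - (b - s * q)) +
  s * ((t + (1 - s) * r) - (b + (1 - s) * q))); last by ring.
by rewrite EFinD !EFinM leeD// lee_wpmul2l.
Qed.

(** Coordinates with second axis [d] make the displacements vertical and scale all three areas by
    the same determinant. The conclusion is kept in the form of a common bound [C], that is,
    quasi-convexity in time. *)
Lemma area_le_interpolation N N1 N2 (s : R) d (C : \bar R) : 0 <= s -> s <= 1 ->
  compact N -> compact N1 -> compact N2 -> convex_set N1 -> convex_set N2 ->
  (forall z, N z -> exists r : R, N1 (z - (s * r) *: d) /\ N2 (z + ((1 - s) * r) *: d)) ->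
  (area N1 <= C)%E -> (area N2 <= C)%E -> (area N <= C)%E.
Proof.
move=> s0 s1 cN cN1 cN2 vN1 vN2 NN N1C N2C.
have os0 : 0 <= 1 - s by rewrite subr_ge0.
have [d0|d0] := eqVneq d 0.
  apply: le_trans N1C; apply: le_area; try exact: compact_measurable_plane.
  by move=> z /NN[r]; rewrite d0 scaler0 subr0 => -[].
have D := cross_neq0 d0; set e := (d.2, - d.1) in D.
have cvx A : convex_set A -> convex_set (aff e d 0 @^-1` A).
  move=> /convex_setP cA; apply/convex_setP => x y t t0 t1 Ax Ay.
  rewrite /preimage/= (_ : aff e d 0 _ = t *: aff e d 0 x + (1 - t) *: aff e d 0 y); first exact: cA.
  by rewrite !affE; apply: eq_planeP; rewrite !scale_pairE /=; ring.
have I : (area N <= (1 - s)%:E * area N1 + s%:E * area N2)%E.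
  rewrite -(@area_aff_preimage _ e d 0 N)//; last exact: compact_measurable_plane.
  rewrite -(@area_aff_preimage _ e d 0 N1)//; last exact: compact_measurable_plane.
  rewrite -(@area_aff_preimage _ e d 0 N2)//; last exact: compact_measurable_plane.
  rewrite !(muleCA _ `|_|%:E) -ge0_muleDr ?mule_ge0 ?lee_fin ?area_ge0//.
  apply: lee_wpmul2l; first by rewrite lee_fin.
  apply: area_le_vertical_interpolation => //; try exact: compact_aff_preimage; try exact: cvx.
  move=> z Nz; have [r [N1z N2z]] := NN _ Nz; exists r; split.
    rewrite /preimage/= (_ : aff _ _ _ _ = aff e d 0 z - (s * r) *: d)//.
    by rewrite !affE; apply: eq_planeP; rewrite !scale_pairE /=; ring.
  rewrite /preimage/= (_ : aff _ _ _ _ = aff e d 0 z + ((1 - s) * r) *: d)//.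
  by rewrite !affE; apply: eq_planeP; rewrite !scale_pairE /=; ring.
apply: (le_trans I).
apply: (@le_trans _ _ ((1 - s)%:E * C + s%:E * C)%E).
  by apply: leeD; apply: lee_wpmul2l; rewrite ?lee_fin.
by rewrite -ge0_muleDl ?lee_fin// -EFinD subrK mul1e.
Qed.

End Slicing.

(** * The bodies swept out by coefficient pairs *)

Section PairSum.
Variable R : realType.
Implicit Types (K L A : set (R * R)) (x y z w d : R * R).

(** This is [N(K)] for an abstract coefficient set [B]; the points [x] and [y] vary independently in
    [K]. *)
Definition pair_sum (B K : set (R * R)) : set (R * R) :=
  [set z | exists c x y, [/\ B c, K x, K y & z = c.1 *: x - c.2 *: y]].

(** The inclusion of [kA + lA] in [(k + l)A] for convex [A]; if both weights vanish, any point of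
    [A] serves as [z]. *)
Lemma convex_weighted A (k l : R) x y : convex_set A -> 0 <= k -> 0 <= l -> A x -> A y ->
  exists2 z, A z & k *: x + l *: y = (k + l) *: z.
Proof.
move=> /convex_setP cA k0 l0 Ax Ay.
have [kl0|kl0] := eqVneq (k + l) 0.
  exists x => //; move/eqP : kl0; rewrite paddr_eq0// => /andP[/eqP kE /eqP lE].
  by apply: eq_planeP; rewrite !scale_pairE/= kE lE; ring.
have kl : 0 < k + l by rewrite lt_neqAle eq_sym kl0 addr_ge0.
exists ((k / (k + l)) *: x + (1 - k / (k + l)) *: y).
  apply: cA => //; first by rewrite divr_ge0// ltW.
  by rewrite ler_pdivrMr// mul1r lerDl.
by apply: eq_planeP; rewrite !scale_pairE/=; field.
Qed.

Variable B : set (R * R).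
Hypotheses (compactB : compact B) (convexB : convex_set B).
Hypothesis B_ge0 : forall c, B c -> 0 <= c.1 /\ 0 <= c.2.
Hypotheses (B10 : B (1, 0)) (B01 : B (0, 1)).

Lemma sub_pair_sum K L : K `<=` L -> pair_sum B K `<=` pair_sum B L.
Proof. by move=> KL z [c [x [y [Bc Kx Ky ->]]]]; exists c, x, y; split=> //; exact: KL. Qed.

Lemma pair_sum_left K x : K 0 -> K x -> pair_sum B K x.
Proof. by move=> K0 Kx; exists (1, 0), x, 0; split => //=; rewrite scale1r scaler0 subr0. Qed.

Lemma pair_sum_right K x : K 0 -> K x -> pair_sum B K (- x).
Proof. by move=> K0 Kx; exists (0, 1), 0, x; split => //=; rewrite scale1r scaler0 sub0r. Qed.

Lemma compact_pair_sum K : compact K -> compact (pair_sum B K).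
Proof.
move=> cK.
pose f (u : (R * R) * ((R * R) * (R * R))) : R * R := u.1.1 *: u.2.1 - u.1.2 *: u.2.2.
have -> : pair_sum B K = f @` (B `*` (K `*` K)).
  apply/seteqP; split=> [z [c [x [y [Bc Kx Ky ->]]]]|_ [[c [x y]] [Bc [Kx Ky]] <-]].
    by exists (c, (x, y)).
  by exists c, x, y.
apply: continuous_compact; last by apply: compact_setX => //; exact: compact_setX.
apply: continuous_subspaceT => u; apply: cvgB; apply: cvgZ.
- by apply: (@cvg_comp _ _ _ fst fst); exact: cvg_fst.
- by apply: (@cvg_comp _ _ _ snd fst); [exact: cvg_snd|exact: cvg_fst].
- by apply: (@cvg_comp _ _ _ fst snd); [exact: cvg_fst|exact: cvg_snd].
- by apply: (@cvg_comp _ _ _ snd snd); exact: cvg_snd.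
Qed.

(** The coefficient pairs are averaged in [B]. Since they are nonnegative, the [x] parts merge into
    a single point of [K] by [convex_weighted], and so do the [y] parts. *)
Lemma convex_pair_sum K : convex_set K -> convex_set (pair_sum B K).
Proof.
move=> cK; apply/convex_setP => _ _ t t0 t1 [c [x [y [Bc Kx Ky ->]]]] [c' [x' [y' [Bc' Kx' Ky' ->]]]].
have [c10 c20] := B_ge0 Bc; have [c10' c20'] := B_ge0 Bc'.
have t'0 : 0 <= 1 - t by rewrite subr_ge0.
have [x'' Kx'' ex] := convex_weighted cK (mulr_ge0 t0 c10) (mulr_ge0 t'0 c10') Kx Kx'.
have [y'' Ky'' ey] := convex_weighted cK (mulr_ge0 t0 c20) (mulr_ge0 t'0 c20') Ky Ky'.
exists (t *: c + (1 - t) *: c'), x'', y''; split => //.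
  by move/convex_setP : convexB; apply.
rewrite (_ : (_ + _).1 = t * c.1 + (1 - t) * c'.1)// (_ : (_ + _).2 = t * c.2 + (1 - t) * c'.2)//.
rewrite -ex -ey !scalerBr !scalerA opprD.
by rewrite !addrA; congr (_ + _); rewrite addrAC.
Qed.

Lemma pair_sum_aff a b K : pair_sum B (aff a b 0 @` K) = aff a b 0 @` pair_sum B K.
Proof.
have affB (k l : R) x y : k *: aff a b 0 x - l *: aff a b 0 y = aff a b 0 (k *: x - l *: y).
  by rewrite !affE; apply: eq_planeP; rewrite !scale_pairE/=; ring.
apply/seteqP; split=> [z [c [_ [_ [Bc [x Kx <-] [y Ky <-] ->]]]]|_ [z [c [x [y [Bc Kx Ky ->]]]] <-]].
  by rewrite affB; exists (c.1 *: x - c.2 *: y) => //; exists c, x, y.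
by exists c, (aff a b 0 x), (aff a b 0 y); split=> //; rewrite affB.
Qed.

(* A shadow-system argument: moving the points of [K] with constant speeds along
   [d] moves those of [pair_sum B K] with constant speeds along [d] too. *)
Lemma area_pair_sum_interpolation K K1 K2 (s : R) d (C : \bar R) : 0 <= s -> s <= 1 ->
  compact K -> compact K1 -> compact K2 -> convex_set K1 -> convex_set K2 ->
  (forall x, K x -> exists r : R, K1 (x - (s * r) *: d) /\ K2 (x + ((1 - s) * r) *: d)) ->
  (area (pair_sum B K1) <= C)%E -> (area (pair_sum B K2) <= C)%E ->
  (area (pair_sum B K) <= C)%E.
Proof.
move=> s0 s1 cK cK1 cK2 vK1 vK2 KK.
apply: (@area_le_interpolation _ _ _ _ s d) => //; try exact: compact_pair_sum;
  try exact: convex_pair_sum.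
move=> _ [c [x [y [Bc Kx Ky ->]]]].
have [r [K1x K2x]] := KK _ Kx; have [q [K1y K2y]] := KK _ Ky.
(* With the coefficients [c] held fixed, the speed of [c.1 *: x - c.2 *: y] is the same combination
   of the speeds of [x] and [y]. *)
exists (c.1 * r - c.2 * q); split.
  exists c, (x - (s * r) *: d), (y - (s * q) *: d); split=> //.
  by apply: eq_planeP; rewrite !scale_pairE/=; ring.
exists c, (x + ((1 - s) * r) *: d), (y + ((1 - s) * q) *: d); split=> //.
by apply: eq_planeP; rewrite !scale_pairE/=; ring.
Qed.

Definition shift w K : set (R * R) := [set x - w | x in K].

Lemma compact_shift w K : compact K -> compact (shift w K).
Proof.
move=> cK; apply: continuous_image_compact => // x.
by apply: cvgB; [exact: cvg_id|exact: cvg_cst].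
Qed.

Lemma convex_shift w K : convex_set K -> convex_set (shift w K).
Proof.
move=> /convex_setP cK; apply/convex_setP => _ _ t t0 t1 [x Kx <-] [y Ky <-].
exists (t *: x + (1 - t) *: y); first exact: cK.
by apply: eq_planeP; rewrite !scale_pairE/=; ring.
Qed.

Lemma area_shift w K : compact K -> area (shift w K) = area K.
Proof. exact: area_translate. Qed.

(** A translation moves all points along [w1 - w0] at the same speed, so [r = 1] works everywhere.
    Hence a bound at the generators of a hull extends to every [w] in the hull. *)
Lemma convex_sublevel_shift K (C : \bar R) : compact K -> convex_set K ->
  convex_set [set w | (area (pair_sum B (shift w K)) <= C)%E].
Proof.
move=> cK vK; apply/convex_setP => w0 w1 t t0 t1 /= w0C w1C.
apply: (@area_pair_sum_interpolation _ _ _ t (w1 - w0) _ t0 t1 _ _ _ _ _ _ w1C w0C);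
  try exact: compact_shift; try exact: convex_shift.
move=> _ [x Kx <-]; exists 1; split; exists x => //.
  by apply: eq_planeP; rewrite !scale_pairE/=; ring.
by apply: eq_planeP; rewrite !scale_pairE/=; ring.
Qed.

End PairSum.

(** * Convex hulls of finite families *)

Section Hull.
Variable R : realType.
Implicit Types (K L A : set (R * R)) (b x y z w d : R * R) (s : seq (R * R)).

Definition join x A : set (R * R) :=
  [set z | exists t y, [/\ 0 <= t, t <= 1, A y & z = t *: x + (1 - t) *: y]].

(** The separate base point keeps the hull non-empty; it is 0 for the polygons treated as fans from
    the origin. *)
Definition hull b s : set (R * R) := foldr join [set b] s.

Lemma compact_hull b s : compact (hull b s).
Proof.
elim: s => [|x s IH] /=; first exact: compact_set1.
pose f (u : R * (R * R)) : R * R := u.1 *: x + (1 - u.1) *: u.2.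
have -> : join x (hull b s) = f @` (`[0, 1]%classic `*` hull b s).
  apply/seteqP; split=> [z [t [y [t0 t1 hy ->]]]|_ [[t y] [t01 hy] <-]].
    by exists (t, y) => //; split => //=; rewrite in_itv/= t0.
  by exists t, y; move: t01; rewrite /= in_itv/= => /andP[].
apply: continuous_compact; last by apply: compact_setX => //; exact: segment_compact.
apply: continuous_subspaceT => u; apply: cvgD; apply: cvgZ.
- exact: cvg_fst.
- exact: cvg_cst.
- by apply: cvgB; [exact: cvg_cst|exact: cvg_fst].
- exact: cvg_snd.
Qed.

Lemma convex_hull b s : convex_set (hull b s).
Proof.
elim: s => [|x s IH] /=; apply/convex_setP.
  by move=> _ _ t t0 t1 -> ->; apply: eq_planeP; rewrite !scale_pairE/=; ring.
move=> _ _ t t0 t1 [k [y [k0 k1 hy ->]]] [k' [y' [k'0 k'1 hy' ->]]].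
have s0 : 0 <= 1 - t by rewrite subr_ge0.
have l0 : 0 <= 1 - k by rewrite subr_ge0.
have l'0 : 0 <= 1 - k' by rewrite subr_ge0.
have [z hz ez] := convex_weighted IH (mulr_ge0 t0 l0) (mulr_ge0 s0 l'0) hy hy'.
exists (t * k + (1 - t) * k'), z; split => //.
- by rewrite addr_ge0// mulr_ge0.
- by nra.
- rewrite (_ : 1 - (t * k + (1 - t) * k') = t * (1 - k) + (1 - t) * (1 - k')); last by ring.
  by rewrite -ez; apply: eq_planeP; rewrite !scale_pairE/=; ring.
Qed.

Lemma hull_base b s : hull b s b.
Proof.
elim: s => //= x s IH; exists 0, b; split=> //.
by apply: eq_planeP; rewrite !scale_pairE/=; ring.
Qed.

Lemma hull_mem b s x : x \in s -> hull b s x.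
Proof.
elim: s => //= y s IH; rewrite inE => /orP[/eqP ->|/IH hx].
  exists 1, b; split => //; first exact: hull_base.
  by apply: eq_planeP; rewrite !scale_pairE/=; ring.
exists 0, x; split=> //.
by apply: eq_planeP; rewrite !scale_pairE/=; ring.
Qed.

Lemma hull_min b s A : convex_set A -> A b -> (forall x, x \in s -> A x) ->
  hull b s `<=` A.
Proof.
move=> cA Ab; elim: s => [_ _ ->//|x s IH sA] _ [t [y [t0 t1 hy ->]]] /=.
move/convex_setP : cA; apply => //; first by apply: sA; rewrite mem_head.
by apply: IH hy => z zs; apply: sA; rewrite inE zs orbT.
Qed.

Lemma sub_hull b s b' s' : hull b' s' b -> (forall x, x \in s -> hull b' s' x) ->
  hull b s `<=` hull b' s'.
Proof. by apply: hull_min; exact: convex_hull. Qed.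

Lemma sub_hull_mem b s s' : {subset s <= s'} -> hull b s `<=` hull b s'.
Proof.
by move=> ss'; apply: sub_hull; [exact: hull_base|move=> x /ss'; exact: hull_mem].
Qed.

Lemma eq_hull_mem b s s' : s =i s' -> hull b s = hull b s'.
Proof. by move=> ss'; apply/seteqP; split; apply: sub_hull_mem => x; rewrite ss'. Qed.

Lemma image_hull (f : R * R -> R * R) b s :
  (forall t x y, f (t *: x + (1 - t) *: y) = t *: f x + (1 - t) *: f y) ->
  f @` hull b s = hull (f b) (map f s).
Proof.
move=> fA; elim: s => [|x s IH] /=; first by rewrite image_set1.
rewrite -IH; apply/seteqP; split=> [_ [_ [t [y [t0 t1 hy ->]]] <-]|].
  by exists t, (f y); split=> //; exists y.
by move=> _ [t [_ [t0 t1 [y hy <-] ->]]]; rewrite -fA; eexists; last reflexivity; exists t, y.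
Qed.

Lemma shift_hull w b s : shift w (hull b s) = hull (b - w) [seq x - w | x <- s].
Proof.
rewrite /shift image_hull// => t x y.
by apply: eq_planeP; rewrite !scale_pairE/=; ring.
Qed.

(** The speed [r] is the weight of [y] in one representation of [z]. It does not depend on [t], so
    the motion has constant speed. *)
Lemma hull_move_second b x y s d z : hull b (x :: y :: s) z ->
  exists r : R, forall t : R, hull b (x :: y + t *: d :: s) (z + (t * r) *: d).
Proof.
move=> [t [_ [t0 t1 [t' [z' [t'0 t'1 hz' ->]]] ->]]].
exists ((1 - t) * t') => q; exists t, (t' *: (y + q *: d) + (1 - t') *: z'); split=> //.
  by exists t', z'.
by apply: eq_planeP; rewrite !scale_pairE/=; ring.
Qed.

End Hull.

(** * Polygons with a vertex at the origin *)

Section Fans.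
Variable R : realType.
Implicit Types (K L A : set (R * R)) (b x y z w d u : R * R) (s v : seq (R * R)).

(** This equals [cross (y - x) (z - x)], twice the signed area of the triangle; it is positive at a
    strict left turn. *)
Definition orient x y z : R := cross x y + cross y z - cross x z.

Definition unit_triangle : set (R * R) := hull 0 [:: (1, 0); (0, 1)].

(** Twice the signed area of the polygon with vertices 0 and [v], triangulated from 0. *)
Fixpoint fan v : R :=
  if v is x :: v' then (if v' is y :: _ then cross x y else 0) + fan v' else 0.

(** Strict left turns at the interior vertices of the chain; the turns at 0 and at the two ends are
    governed by [positive_cross]. *)
Fixpoint cvx v : bool :=
  if v is x :: v' then
    (if v' is y :: z :: _ then 0 < orient x y z else true) && cvx v'
  else true.

Definition positive_cross x y := 0 < cross x y.

Lemma crossxx x : cross x x = 0. Proof. by rewrite /cross; ring. Qed.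

Lemma triangle_aff a b : hull 0 [:: a; b] = aff a b 0 @` unit_triangle.
Proof.
rewrite image_hull/=; last first.
  by move=> t x y; rewrite !affE; apply: eq_planeP; rewrite !scale_pairE/=; ring.
by congr (hull _ [:: _; _]); apply: eq_planeP; rewrite affE/=; ring.
Qed.

Lemma area_triangle a b : cross a b != 0 ->
  area (hull 0 [:: a; b]) = (`|cross a b|%:E * area unit_triangle)%E.
Proof. by move=> ab; rewrite triangle_aff area_aff_image//; exact: compact_hull. Qed.

Lemma area_unit_triangle_gt0 : (0 < area unit_triangle)%E.
Proof.
apply: (@lt_le_trans _ _ (area ((`[0, 2^-1]%classic `*` `[0, 2^-1]%classic)%R : set (R * R)))).
  rewrite /area product_measure1E//= !lebesgue_measure_itv/=.
  by rewrite lte_fin invr_gt0 ltr0n -EFinB -EFinM lte_fin subr0 mulr_gt0// invr_gt0.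
apply: le_area; [exact: measurable_box|exact: compact_measurable_plane (@compact_hull _ _ _)|].
move=> [x y] /= []; rewrite !in_itv/= => /andP[x0 x2] /andP[y0 y2].
have x1 : 1 - x != 0 by lra.
exists x, (0, y / (1 - x)); split => //; first by lra.
  exists (y / (1 - x)), 0; split => //.
  - by apply: divr_ge0; lra.
  - by rewrite ler_pdivrMr; lra.
  - by apply: eq_planeP; rewrite !scale_pairE/=; ring.
by apply: eq_planeP; rewrite !scale_pairE/=; field.
Qed.

Lemma convex_halfplane d : convex_set [set x | 0 <= cross d x].
Proof.
apply/convex_setP => x y t t0 t1 /= dx dy.
rewrite (_ : cross _ _ = t * cross d x + (1 - t) * cross d y); last first.
  by rewrite /cross !scale_pairE/=; ring.
by rewrite addr_ge0// mulr_ge0// subr_ge0.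
Qed.

(** The triangle on 0, [x], [y] and the hull of 0 and the vertices from [y] on lie on opposite sides
    of the line through 0 and [y], so their areas add up inside the whole hull. *)
Lemma area_hull_ge_fan v : pairwise positive_cross v ->
  (area unit_triangle * (fan v)%:E <= area (hull 0%R v))%E.
Proof.
elim: v => [_|x [|y v] IH]; [by rewrite mule0 area_ge0|by rewrite /= addr0 mule0 area_ge0|].
move=> /= /andP[/andP[xy xv] /andP[yv pv]].
have {}IH := IH (introT andP (conj yv pv)).
set T := hull 0 [:: x; y]; set H := hull 0 (y :: v) in IH.
have mT : measurable T by exact: compact_measurable_plane (@compact_hull _ _ _).
have mH : measurable H by exact: compact_measurable_plane (@compact_hull _ _ _).
have ml := measurable_line y.
have y0 : y != 0 by apply: contraTneq xy => ->; rewrite /positive_cross /cross/= mulr0 mulr0 subrr ltxx.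
have H_ge0 : H `<=` [set z | 0 <= cross y z].
  apply: hull_min; [exact: convex_halfplane|by rewrite /= /cross/=; lra|].
  move=> z; rewrite inE => /orP[/eqP ->|zv]; rewrite /= ?crossxx//.
  by apply/ltW; exact: (allP yv).
have T_le0 : T `<=` [set z | 0 <= cross (- y) z].
  apply: hull_min; [exact: convex_halfplane|by rewrite /= /cross/=; lra|].
  move=> z; rewrite !inE => /orP[]/eqP ->; move: xy; rewrite /positive_cross /cross/=; lra.
(* Removing the null line from the triangle makes the two pieces disjoint. *)
have dTH : (T `\` [set z | cross y z = 0]) `&` H = set0.
  rewrite -subset0 => z [[Tz /= yz] Hz]; apply: yz; apply/eqP.
  rewrite eq_le H_ge0 ?andbT//; have := T_le0 _ Tz; rewrite /= /cross/=; lra.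
have TE : area T = area (T `\` [set z | cross y z = 0]).
  rewrite (areaDI mT ml) -[RHS]adde0; congr (_ + _)%E.
  apply/eqP; rewrite eq_le area_ge0 andbT -(area_line y0); apply: le_area => //.
  exact: measurableI.
apply: (@le_trans _ _ (area (T `\` [set z | cross y z = 0] `|` H))); last first.
  apply: le_area => [||z [[Tz _]|]].
  - by apply: measurableU => //; exact: measurableD.
  - exact: compact_measurable_plane (@compact_hull _ 0 (x :: y :: v)).
  - by apply: (@sub_hull_mem _ 0 [:: x; y] (x :: y :: v)) Tz => a; rewrite !inE => /orP[]->; rewrite ?orbT.
  - by apply: (@sub_hull_mem _ 0 (y :: v) (x :: y :: v)) => a; rewrite !inE => ->; rewrite orbT.
rewrite areaU//; last exact: measurableD.
rewrite -TE (@area_triangle x y); last exact: lt0r_neq0.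
have fT : area unit_triangle \is a fin_num.
  by apply: area_compact_fin_num; exact: compact_hull.
rewrite gtr0_norm// EFinD muleDr//.
by apply: leeD => //; rewrite muleC.
Qed.

End Fans.

(** * Reduction of convex fans to triangles by vertex sliding *)

Section ConvexFans.
Variable R : realType.
Implicit Types (K L A : set (R * R)) (b x y z w d u : R * R) (s v : seq (R * R)).

Variable B : set (R * R).
Hypotheses (compactB : compact B) (convexB : convex_set B).
Hypothesis B_ge0 : forall c, B c -> 0 <= c.1 /\ 0 <= c.2.

Lemma cross_cramer x y z : cross x z *: y = cross y z *: x + cross x y *: z.
Proof. by apply: eq_planeP; rewrite /cross !scale_pairE/=; ring. Qed.

(** When the crosses are positive, left turns along [x y z] and [y z w] give one along [x z w],
    where [y] is skipped. *)
Lemma orient_inner x y z w :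
  cross y z * orient x z w = cross z w * orient x y z + cross x z * orient y z w.
Proof. by rewrite /orient /cross; ring. Qed.

(** The companion identity for the chain [x y w], where [z] is skipped. *)
Lemma orient_outer x y z w :
  cross y z * orient x y w = cross x y * orient y z w + cross y w * orient x y z.
Proof. by rewrite /orient /cross; ring. Qed.

(** Linear equivariance: with [area_triangle], it shows that all triangles at the origin share one
    ratio. *)
Lemma area_pair_sum_triangle a b : cross a b != 0 ->
  area (pair_sum B (hull 0 [:: a; b])) =
  (`|cross a b|%:E * area (pair_sum B (@unit_triangle R)))%E.
Proof.
move=> ab; rewrite triangle_aff pair_sum_aff area_aff_image//.
by apply: compact_pair_sum => //; exact: compact_hull.
Qed.

Lemma area_pair_sum_move x y d v (t1 t2 : R) (C : \bar R) : t1 < 0 -> 0 < t2 ->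
  (area (pair_sum B (hull 0%R [:: x, (y + t1 *: d)%R & v])) <= C)%E ->
  (area (pair_sum B (hull 0%R [:: x, (y + t2 *: d)%R & v])) <= C)%E ->
  (area (pair_sum B (hull 0%R [:: x, y & v])) <= C)%E.
Proof.
move=> t10 t20; have t21 : t2 - t1 != 0 by lra.
(* The given position is time 0 between [t1] and [t2], which yields the weight; rescaling the
   direction by [t2 - t1] normalizes the duration of the motion to 1. *)
apply: (@area_pair_sum_interpolation _ _ compactB convexB B_ge0 _ _ _ (- t1 / (t2 - t1)) ((t2 - t1) *: d));
  try exact: compact_hull; try exact: convex_hull.
- by apply: divr_ge0; lra.
- by rewrite ler_pdivrMr; lra.
move=> z /(hull_move_second d)[r hr]; exists r; split.
  move: (hr t1); congr (hull _ _ _).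
  by apply: eq_planeP; rewrite !scale_pairE/=; field.
move: (hr t2); congr (hull _ _ _).
by apply: eq_planeP; rewrite !scale_pairE/=; field.
Qed.

Lemma hull_segment s x (k : R) : 1 <= k -> hull 0 s (k *: x) -> hull 0 s x.
Proof.
move=> k1 hx; have k0 : k != 0 by lra.
rewrite (_ : x = k^-1 *: (k *: x) + (1 - k^-1) *: 0).
  move: (@convex_hull _ 0 s) => /convex_setP; apply => //; last exact: hull_base.
    by rewrite invr_ge0; lra.
  by rewrite invf_le1; lra.
by apply: eq_planeP; rewrite !scale_pairE/=; field.
Qed.

Let alpha := area (pair_sum B (@unit_triangle R)).

(* Sliding the second vertex along the line through it parallel to the diagonal
   of its neighbours preserves [fan]; in both directions it stops when a
   neighbour becomes redundant. *)
Lemma area_pair_sum_convex_fan n v : size v = n.+2 -> pairwise (@positive_cross R) v -> cvx v ->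
  (area (pair_sum B (hull 0%R v)) <= alpha * (fan v)%:E)%E.
Proof.
elim: n v => [|n IH] [|x [|y v]]//= [sv].
  move/size0nil : sv => -> /=; rewrite !andbT => xy _.
  have xy0 : cross x y != 0 by exact: lt0r_neq0.
  rewrite (@area_pair_sum_triangle x y)// !addr0 muleC gtr0_norm//.
case: v sv => [|z v] // [sv].
move=> /and4P[/and3P[xy xz xv] /andP[yz yv] zv pv] /andP[oxyz cv].
rewrite /positive_cross in xy xz yz.
have {}pv : pairwise (@positive_cross R) v by exact: pv.
have {}cv : cvx [:: y, z & v] by exact: cv.
pose d := z - x.
(* By Cramer's rule the line through [y] along [d] meets the rays of [x] and [z] at [mu *: x] and
   [mu *: z], with the same factor; the left turn at [y] gives [mu >= 1]. *)
pose mu := (cross x y + cross y z) / cross x z.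
have xz0 : cross x z != 0 by rewrite gt_eqF.
have mu1 : 1 <= mu.
  by rewrite ler_pdivlMr// mul1r; move: oxyz; rewrite /orient; lra.
have mu0 : 0 < mu by lra.
have wE : y + (- (cross x y / cross x z)) *: d = mu *: x.
  apply: (scalerI xz0); rewrite scalerDr cross_cramer /mu /d.
  by apply: eq_planeP; rewrite !scale_pairE/=; field.
have w'E : y + (cross y z / cross x z) *: d = mu *: z.
  apply: (scalerI xz0); rewrite scalerDr cross_cramer /mu /d.
  by apply: eq_planeP; rewrite !scale_pairE/=; field.
have crossZl k a c : cross (k *: a) c = k * cross a c.
  by rewrite /cross !scale_pairE/=; ring.
have crossZr k a c : cross a (k *: c) = k * cross a c.
  by rewrite /cross !scale_pairE/=; ring.
have left_end : (area (pair_sum B (hull 0%R [:: x, (mu *: x)%R, z & v])) <=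
    alpha * (cross x y + (cross y z + fan (z :: v)))%:E)%E.
  have -> : (cross x y + (cross y z + fan (z :: v))) = fan [:: mu *: x, z & v].
    by rewrite addrA /= crossZl /mu; congr (_ + _); field.
  apply: le_trans (IH [:: mu *: x, z & v] _ _ _).
  - apply: le_area; try (apply: compact_measurable_plane; apply: compact_pair_sum => //; exact: compact_hull).
    apply: sub_pair_sum; apply: sub_hull; first exact: hull_base.
    move=> a; rewrite inE => /orP[/eqP ->|]; last exact: hull_mem.
    by apply: (hull_segment mu1); apply: hull_mem; rewrite mem_head.
  - by rewrite /= sv.
  - rewrite /= zv pv {1}/positive_cross crossZl mulr_gt0//= andbT.
    by apply/allP => a av; rewrite /positive_cross crossZl mulr_gt0//; exact: (allP xv).
  - case: v {sv} xv yv zv pv cv => [//|a v] /= /andP[xa _] _ /andP[za _] _ /andP[oyza ->].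
    rewrite andbT -wE.
    have oxza : 0 < orient x z a.
      by rewrite -(pmulr_rgt0 _ yz) orient_inner addr_gt0// mulr_gt0.
    have -> k : orient (y + - k *: d) z a = orient y z a + k * orient x z a.
      by rewrite /d /orient /cross !scale_pairE/=; ring.
    by rewrite addr_gt0// mulr_gt0// divr_gt0.
have t1 : - (cross x y / cross x z) < 0 by rewrite oppr_lt0 divr_gt0.
(* The right end depends on what follows [z]. If [z] is the last vertex, [y] slides onto its ray and
   [z] becomes redundant. *)
case: v sv xv yv zv pv cv left_end => [|a v] sv xv yv zv pv cv left_end.
  have t2_gt0 : 0 < cross y z / cross x z by rewrite divr_gt0.
  apply: (@area_pair_sum_move x y d [:: z] _ _ _ t1 t2_gt0); first by rewrite wE.
  rewrite w'E.
  have -> : cross x y + (cross y z + (0 + 0)) = fan [:: x; mu *: z].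
    by rewrite /= crossZr /mu !addr0; field.
  apply: le_trans (IH [:: x; mu *: z] _ _ _) => //.
  - apply: le_area; try (apply: compact_measurable_plane; apply: compact_pair_sum => //; exact: compact_hull).
    apply: sub_pair_sum; apply: sub_hull; first exact: hull_base.
    move=> c; rewrite !inE => /or3P[] /eqP ->.
    + by apply: hull_mem; rewrite !inE eqxx.
    + by apply: hull_mem; rewrite !inE eqxx orbT.
    + by apply: (hull_segment mu1); apply: hull_mem; rewrite !inE eqxx orbT.
  - by rewrite -sv.
  - by rewrite /= /positive_cross crossZr mulr_gt0.
move: xv yv zv pv cv => /= /andP[xa xv] /andP[ya yv] /andP[za zv] /andP[av pv] /andP[oyza cv].
rewrite /positive_cross in xa ya za.
have {}pv : pairwise (@positive_cross R) v by exact: pv.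
have {}xv : all (positive_cross x) v by exact: xv.
have {}av : all (positive_cross a) v by exact: av.
have oxza : 0 < orient x z a.
  by rewrite -(pmulr_rgt0 _ yz) orient_inner addr_gt0// mulr_gt0.
(* With a next vertex [a], the slide stops when the moved vertex [w] is collinear with [z] and [a]:
   [orient w z a] is affine in time with slope [- orient x z a]. *)
pose t2 := orient y z a / orient x z a.
have t2_gt0 : 0 < t2 by rewrite divr_gt0.
apply: (@area_pair_sum_move x y d [:: z, a & v] _ _ _ t1 t2_gt0); first by rewrite wE.
pose w := y + t2 *: d; rewrite -/w.
(* This number is [cross w z]: the stop comes before [w] reaches the ray of [z]. *)
have k1_gt0 : 0 < cross y z - t2 * cross x z.
  have : cross z a * orient x y z = orient x z a * (cross y z - t2 * cross x z).
    transitivity (cross y z * orient x z a - cross x z * (t2 * orient x z a)); last by ring.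
    by rewrite /t2 divfK ?gt_eqF// orient_inner; ring.
  by move=> E; rewrite -(pmulr_rgt0 _ oxza) -E mulr_gt0.
have k3_gt0 : 0 < cross x y + t2 * cross x z by rewrite addr_gt0// mulr_gt0.
(* Thus [w] is a positive combination of [x] and [z], so all later vertices remain counterclockwise
   from it. *)
have crossw c : cross x z * cross w c =
    (cross y z - t2 * cross x z) * cross x c + (cross x y + t2 * cross x z) * cross z c.
  by rewrite /w /d /cross !scale_pairE/=; ring.
have crossw_gt0 c : 0 < cross x c -> 0 < cross z c -> 0 < cross w c.
  by move=> xc zc; rewrite -(pmulr_rgt0 _ xz) crossw addr_gt0// mulr_gt0.
have xw : cross x w = cross x y + t2 * cross x z.
  by rewrite /w /d /cross !scale_pairE/=; ring.
have wz : cross w z = cross y z - t2 * cross x z.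
  by rewrite /w /d /cross !scale_pairE/=; ring.
have owza : orient w z a = 0.
  rewrite (_ : orient w z a = orient y z a - t2 * orient x z a).
    by rewrite /t2 divfK ?subrr// gt_eqF.
  by rewrite /w /d /orient /cross !scale_pairE/=; ring.
have oxwz : orient x w z = orient x y z.
  by rewrite /w /d /orient /cross !scale_pairE/=; ring.
have wa : cross w a = cross w z + cross z a by move: owza; rewrite /orient; lra.
have wa0 : 0 < cross w a by exact: crossw_gt0.
have oxwa : 0 < orient x w a.
  have wz0 : 0 < cross w z by rewrite wz.
  by rewrite -(pmulr_rgt0 _ wz0) orient_outer owza mulr0 add0r oxwz mulr_gt0.
have -> : cross x y + (cross y z + (cross z a + fan (a :: v))) = fan [:: x, w, a & v].
  by rewrite /= xw wa wz; ring.
apply: le_trans (IH [:: x, w, a & v] _ _ _) => //.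
- apply: le_area; try (apply: compact_measurable_plane; apply: compact_pair_sum => //; exact: compact_hull).
  apply: sub_pair_sum; apply: sub_hull; first exact: hull_base.
  move=> c; rewrite !inE => /orP[/eqP->|/orP[/eqP->|/orP[/eqP->|cav]]].
  + by apply: hull_mem; rewrite mem_head.
  + by apply: hull_mem; rewrite !inE eqxx orbT.
  (* Collinearity gives [cross w a = cross w z + cross z a], so [z] lies on the segment from [w] to
     [a]. *)
  + have -> : z = (cross z a / cross w a) *: w + (1 - cross z a / cross w a) *: a.
      have wa_neq0 : cross w a != 0 by rewrite gt_eqF.
      apply: (scalerI wa_neq0); rewrite cross_cramer wa.
      rewrite wa in wa_neq0.
      by apply: eq_planeP; rewrite !scale_pairE/=; field.
    move: (@convex_hull _ 0 [:: x, w, a & v]) => /convex_setP; apply.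
    * by rewrite divr_ge0// ltW.
    * by rewrite ler_pdivrMr// mul1r wa lerDr wz ltW.
    * by apply: hull_mem; rewrite !inE eqxx orbT.
    * by apply: hull_mem; rewrite !inE eqxx !orbT.
  + by apply: hull_mem; rewrite !inE in cav *; rewrite cav !orbT.
- by move: sv => /= [->].
- rewrite /= /positive_cross xw k3_gt0 xa wa0 xv av pv !andbT /=.
  by apply/allP => c cv'; apply: crossw_gt0; [exact: (allP xv)|exact: (allP zv)].
- rewrite /= oxwa /=.
  case: v {sv xv yv zv pv left_end} av cv => [|e v] //= /andP[ae _] /andP[ozae ->].
  by rewrite andbT -(pmulr_rgt0 _ za) orient_inner owza mulr0 add0r mulr_gt0.
Qed.

End ConvexFans.

(** * The inequality for an arbitrary coefficient set *)

Section PairSumInequality.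
Variable R : realType.
Implicit Types (K L A : set (R * R)) (b x y z w d u : R * R) (s v : seq (R * R)).

Definition pair_sum_const (B : set (R * R)) : R :=
  fine (area (pair_sum B (@unit_triangle R))) / fine (area (@unit_triangle R)).

Variable B : set (R * R).
Hypotheses (compactB : compact B) (convexB : convex_set B).
Hypothesis B_ge0 : forall c, B c -> 0 <= c.1 /\ 0 <= c.2.

(* The separating normal is the point of [A] nearest to the origin. *)
Lemma separation0 A : compact A -> convex_set A -> A !=set0 -> ~ A 0 ->
  exists u, forall x, A x -> 0 < dot u x.
Proof.
move=> cA vA A0 nA0.
have cn : {within A, continuous (fun x : R * R => dot x x)}.
  apply: continuous_subspaceT => x; apply: cvgD; apply: cvgM; by [exact: cvg_fst|exact: cvg_snd].
have [m] := compact_EVT_min A0 cA cn; rewrite inE => Am mmin.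
have mm0 : 0 < dot m m.
  rewrite lt_neqAle /dot addr_ge0 ?sqr_ge0 -?expr2 ?sqr_ge0// andbT eq_sym.
  rewrite paddr_eq0 ?sqr_ge0// !sqrf_eq0; apply/negP => /andP[/eqP m1 /eqP m2].
  by apply: nA0; rewrite (_ : 0 = m)//; apply: eq_planeP; rewrite ?m1 ?m2.
exists m => x Ax; apply: (lt_le_trans mm0); rewrite leNgt; apply/negP => xm.
pose a := dot m x - dot m m; pose q := dot (x - m) (x - m).
have a0 : a < 0 by rewrite subr_lt0.
have q0 : 0 <= q by rewrite /q /dot -!expr2 addr_ge0// sqr_ge0.
have qa : 0 < q - a by lra.
(* For this [t] one has [t * q < - a], so [2 * a + t * q] is negative and the point at parameter [t]
   is nearer to the origin than [m]. *)
pose t := - a / (q - a).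
have t0 : 0 < t by rewrite divr_gt0// oppr_gt0.
have t1 : t <= 1 by rewrite ler_pdivrMr//; lra.
have At : A (t *: x + (1 - t) *: m) by move/convex_setP : vA; apply => //; exact: ltW.
have := mmin _ (mem_set At).
rewrite (_ : dot (t *: x + _) _ = dot m m + t * (2 * a + t * q)); last first.
  by rewrite /a /q /dot !scale_pairE/=; ring.
rewrite lerDl pmulr_rge0// => H.
have tq : t * q = - a * (q / (q - a)) by rewrite /t; field; rewrite gt_eqF.
have : q / (q - a) < 1 by rewrite ltr_pdivrMr// mul1r; lra.
by move: H; rewrite tq; nra.
Qed.

Lemma dot_cross_swap u x y : cross x y = 0 -> dot u y *: x = dot u x *: y.
Proof.
move=> xy; apply: eq_planeP; rewrite !scale_pairE/=; apply/eqP; rewrite -subr_eq0.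
  by rewrite (_ : _ - _ = u.2 * cross x y); [rewrite xy mulr0|rewrite /dot /cross; ring].
by rewrite (_ : _ - _ = - u.1 * cross x y); [rewrite xy mulr0|rewrite /dot /cross; ring].
Qed.

Lemma parallel_in_hull u x y s : 0 < dot u x -> dot u x <= dot u y -> cross x y = 0 ->
  y \in s -> hull 0 s x.
Proof.
move=> ux uxy xy ys; apply: (@hull_segment _ _ _ (dot u y / dot u x)).
  by rewrite ler_pdivlMr// mul1r.
rewrite mulrC -scalerA (dot_cross_swap _ xy) scalerA mulVf ?gt_eqF// scale1r.
exact: hull_mem.
Qed.

Lemma crossC x y : cross x y = - cross y x.
Proof. by rewrite /cross; ring. Qed.

(** Strictness can fail in two ways. Of two vertices on one ray, the shorter is redundant; at a turn
    that is not strictly left, the middle vertex lies in the hull of 0 and its neighbours. *)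
Lemma convex_fan_or_redundant u v : all (fun x => 0 < dot u x) v ->
  pairwise (fun x y => 0 <= cross x y) v ->
  (pairwise (@positive_cross R) v /\ cvx v) \/
  exists s1 x s2, v = s1 ++ x :: s2 /\ hull 0 (s1 ++ s2) x.
Proof.
elim: v => [|x v IH] /=; first by left.
move=> /andP[ux uv] /andP[xv pv].
have [[{}pv cv]|[s1 [y [s2 [vE hy]]]]] := IH uv pv; last first.
  right; exists (x :: s1), y, s2; split; first by rewrite vE.
  by apply: sub_hull_mem hy => a; rewrite inE => ->; rewrite orbT.
have [xv0|/allPn[y yv]] := boolP (all (positive_cross x) v); last first.
  rewrite /positive_cross -leNgt => xy; right.
  have xy0 : cross x y = 0 by apply/eqP; rewrite eq_le xy (allP xv).
  have uy := allP uv _ yv.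
  have [uxy|uyx] := leP (dot u x) (dot u y).
    by exists [::], x, v; split => //=; exact: parallel_in_hull uxy xy0 yv.
  have [s1 [s2 vE]] : exists s1 s2, v = s1 ++ y :: s2.
    by case/splitPr : yv => s1 s2; exists s1, s2.
  exists (x :: s1), y, s2; split; first by rewrite vE.
  apply: (parallel_in_hull uy (ltW uyx)); last exact: mem_head.
  by rewrite crossC xy0 oppr0.
have pxv : pairwise (@positive_cross R) (x :: v) by apply/andP.
case: v cv xv0 pv pxv {uv xv IH} => [|y [|z v]] cv xv0 pv pxv; [by left|by left|].
have [oxyz|oxyz] := ltP 0 (orient x y z); first by left; split=> //; exact/andP.
right; exists [:: x], y, (z :: v); split=> //=.
move: xv0 => /= /and3P[xy xz _]; move: pv => /= /andP[/andP[yz _] _].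
rewrite /positive_cross in xy yz xz.
have xyz0 : 0 < cross x y + cross y z by rewrite addr_gt0.
have xyz1 : cross x y + cross y z != 0 by rewrite gt_eqF.
(* The ray of [y] meets the segment from [x] to [z] at this multiple of [y], which is at least 1
   since the turn is not strictly left. *)
apply: (@hull_segment _ [:: x, z & v] _ (cross x z / (cross x y + cross y z))).
  by rewrite ler_pdivlMr// mul1r; move: oxyz; rewrite /orient; lra.
have -> : (cross x z / (cross x y + cross y z)) *: y =
    (cross y z / (cross x y + cross y z)) *: x + (1 - cross y z / (cross x y + cross y z)) *: z.
  rewrite [X in X *: y]mulrC -[LHS]scalerA (cross_cramer x y z).
  by apply: eq_planeP; rewrite !scale_pairE/=; field.
move: (@convex_hull _ 0 [:: x, z & v]) => /convex_setP; apply.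
- by rewrite divr_ge0// ltW.
- by rewrite ler_pdivrMr// mul1r lerDr ltW.
- by apply: hull_mem; rewrite mem_head.
- by apply: hull_mem; rewrite !inE eqxx orbT.
Qed.

Let alpha := fine (area (pair_sum B (@unit_triangle R))).
Let tau := fine (area (@unit_triangle R)).
Let c := pair_sum_const B.

Lemma area_unit_triangleE : area (@unit_triangle R) = tau%:E.
Proof. by rewrite fineK// area_compact_fin_num//; exact: compact_hull. Qed.

Lemma area_pair_sum_unit_triangleE : area (pair_sum B (@unit_triangle R)) = alpha%:E.
Proof.
by rewrite fineK// area_compact_fin_num//; apply: compact_pair_sum => //; exact: compact_hull.
Qed.

Lemma fine_area_unit_triangle_gt0 : 0 < tau.
Proof. by rewrite -lte_fin -area_unit_triangleE; exact: area_unit_triangle_gt0. Qed.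

Lemma pair_sum_const_ge0 : 0 <= c.
Proof. by rewrite divr_ge0 ?(ltW fine_area_unit_triangle_gt0)// fine_ge0// area_ge0. Qed.

Lemma area_pair_sum_line K d : compact K -> d != 0 -> (forall x, K x -> cross d x = 0) ->
  area (pair_sum B K) = 0%E.
Proof.
move=> cK d0 dK; apply/eqP; rewrite eq_le area_ge0 andbT -(area_line d0); apply: le_area.
- by apply: compact_measurable_plane; exact: compact_pair_sum.
- exact: measurable_line.
- move=> _ [k [x [y [Bk Kx Ky ->]]]] /=.
  rewrite (_ : cross _ _ = k.1 * cross d x - k.2 * cross d y).
    by rewrite !dK// !mulr0 subrr.
  by rewrite /cross !scale_pairE/=; ring.
Qed.

(** In an open half-plane the generators can be sorted by angle; redundant ones are then discarded
    by induction until a strictly convex fan remains. *)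
Lemma area_pair_sum_pointed u v : all (fun x => 0 < dot u x) v ->
  (area (pair_sum B (hull 0%R v)) <= c%:E * area (hull 0%R v))%E.
Proof.
have [n] := ubnP (size v); elim: n v => // n IH v; rewrite ltnS => vn uv.
pose r x y := 0 <= cross x y.
have r_total : total r by move=> x y; rewrite /r (crossC y x) oppr_ge0 le_total.
(* Angular order is transitive only within a half-plane: the positive weights [dot u _] enter the
   identity below. *)
have r_trans : {in (fun x => 0 < dot u x) & &, transitive r}.
  move=> y x z uy ux uz xy yz; rewrite /r -(pmulr_rge0 _ uy).
  rewrite (_ : _ * _ = dot u z * cross x y + dot u x * cross y z).
    by rewrite addr_ge0// mulr_ge0// ltW.
  by rewrite /dot /cross; ring.
pose v' := sort r v.
have uv' : all (fun x => 0 < dot u x) v' by rewrite all_sort.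
have pv' : pairwise r v' by rewrite -(sorted_pairwise_in r_trans uv') sort_sorted.
have -> : hull 0 v = hull 0 v' by apply: eq_hull_mem => x; rewrite mem_sort.
have {vn} : (size v' <= n)%N by rewrite size_sort.
move: v' uv' pv' => {uv}{}v uv pv vn.
have [[{}pv cv]|[s1 [x [s2 [vE hx]]]]] := convex_fan_or_redundant uv pv; last first.
  have -> : hull 0 v = hull 0 (s1 ++ s2).
    apply/seteqP; split.
      apply: sub_hull; first exact: hull_base.
      move=> y; rewrite vE mem_cat inE orbCA => /orP[/eqP ->//|ys].
      by apply: hull_mem; rewrite mem_cat.
    apply: sub_hull_mem => y; rewrite vE !mem_cat inE => /orP[->//|->].
    by rewrite !orbT.
  apply: IH; first by apply: leq_trans vn; rewrite vE !size_cat/= addnS.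
  by move: uv; rewrite vE !all_cat/= => /and3P[-> _ ->].
have [/eqP v0|v1] := leqP (size v) 1; last first.
  move: v1 => /subnKC; rewrite add2n => /esym vs.
  (* Both bounds pass through the fan: [alpha * fan v = c * (tau * fan v)], and [tau * fan v] is at
     most the area of the hull. *)
  have fan_le := area_pair_sum_convex_fan compactB convexB B_ge0 vs pv cv.
  apply: (le_trans fan_le); have := area_hull_ge_fan pv.
  rewrite area_unit_triangleE area_pair_sum_unit_triangleE => /(lee_wpmul2l (_ : 0 <= c%:E)%E) H.
  apply: le_trans (H _); last by rewrite lee_fin pair_sum_const_ge0.
  by rewrite -!EFinM mulrA /c /pair_sum_const divfK// gt_eqF// fine_area_unit_triangle_gt0.
(* At most one vertex is left, so the hull lies on a line through 0 and its [pair_sum] is null. *)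
have [d d0 dv] : exists2 d, d != 0 & forall x, x \in v -> cross d x = 0.
  case: v uv v0 {pv cv vn} => [|x [|//]].
    by exists (1, 0) => //; rewrite -[_ == _]/(_ && _)/= oner_eq0.
  move=> /= /andP[ux _] _; exists x.
    by apply: contraTneq ux => ->; rewrite /dot/= !mulr0 addr0 ltxx.
  by move=> y; rewrite inE => /eqP ->; rewrite crossxx.
rewrite (@area_pair_sum_line _ d)//; first by rewrite mule_ge0 ?area_ge0// lee_fin pair_sum_const_ge0.
  exact: compact_hull.
suff : hull 0 v `<=` [set x | cross d x = 0] by [].
apply: hull_min => //; last by rewrite /= /cross/=; ring.
apply/convex_setP => x y k k0 k1 /= dx dy.
rewrite (_ : cross _ _ = k * cross d x + (1 - k) * cross d y).
  by rewrite dx dy; ring.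
by rewrite /cross !scale_pairE/=; ring.
Qed.

End PairSumInequality.

(** * From pointed polygons to general convex bodies *)

Section PairSumGeneral.
Variable R : realType.
Implicit Types (K L A : set (R * R)) (b x y z w d u : R * R) (s v : seq (R * R)).

Variable B : set (R * R).
Hypotheses (compactB : compact B) (convexB : convex_set B).
Hypothesis B_ge0 : forall c, B c -> 0 <= c.1 /\ 0 <= c.2.
Hypothesis B_le1 : forall c, B c -> c.1 <= 1 /\ c.2 <= 1.
Hypotheses (B10 : B (1, 0)) (B01 : B (0, 1)).

Let c := pair_sum_const B.

(** After reduction to a generator [x], either [x] is separated from the others, which is the
    pointed case, or it lies in their hull and is removed. The induction covers every [w] in the
    hull because the removed [x] stays the origin of the smaller polygon. *)
Lemma area_pair_sum_polygon b s w : hull b s w ->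
  (area (pair_sum B (shift w (hull b s))) <= c%:E * area (hull b s))%E.
Proof.
have [n] := ubnP (size s); elim: n b s w => // n IH b s w; rewrite ltnS => sn.
set C : \bar R := (_ * _)%E.
have sub_level : convex_set [set w | (area (pair_sum B (shift w (hull b s))) <= C)%E].
  by apply: convex_sublevel_shift => //; [exact: compact_hull|exact: convex_hull].
(* Convexity of the sublevel set moves the origin to a generator. *)
suff H x : x \in b :: s -> (area (pair_sum B (shift x (hull b s))) <= C)%E.
  move: w; apply: (hull_min sub_level); first by apply: H; rewrite mem_head.
  by move=> x xs; apply: H; rewrite inE xs orbT.
move=> {w} xbs; have /perm_mem bsE := perm_to_rem xbs.
have ss' : size (rem x (b :: s)) = size s by rewrite size_rem.
move: (rem x _) bsE ss' => s' bsE ss'.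
have hE : hull b s = hull x s'.
  have mem y : y \in b :: s -> hull x s' y.
    by rewrite bsE inE => /orP[/eqP ->|]; [exact: hull_base|exact: hull_mem].
  have mem' y : y \in x :: s' -> hull b s y.
    by rewrite -bsE inE => /orP[/eqP ->|]; [exact: hull_base|exact: hull_mem].
  apply/seteqP; split; apply: sub_hull.
  - by apply: mem; rewrite mem_head.
  - by move=> y ys; apply: mem; rewrite inE ys orbT.
  - by apply: mem'; rewrite mem_head.
  - by move=> y ys; apply: mem'; rewrite inE ys orbT.
rewrite /C hE.
have [hsep|[y [s'' [s'E hx]]]] : (exists u, all (fun y => 0 < dot u y) [seq y - x | y <- s']) \/
    exists y s'', s' = y :: s'' /\ hull y s'' x.
- case: s' {bsE ss' hE} => [|y s'']; first by left; exists 0.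
  have [hx|hx] := pselect (hull y s'' x); first by right; exists y, s''.
  left; have [||||u hu] := @separation0 _ (shift x (hull y s'')).
  + by apply: compact_shift; exact: compact_hull.
  + by apply: convex_shift; exact: convex_hull.
  + by exists (y - x); exists y => //; exact: hull_base.
  + by move=> [z hz /eqP]; rewrite subr_eq0 => /eqP zx; apply: hx; rewrite -zx.
  + exists u; apply/allP => _ /mapP[z zs ->]; apply: hu; exists z => //.
    by move: zs; rewrite inE => /orP[/eqP ->|]; [exact: hull_base|exact: hull_mem].
- case: hsep => u hu; rewrite -(@area_shift _ x (hull x s')); last exact: compact_hull.
  by rewrite shift_hull subrr; exact: (area_pair_sum_pointed compactB convexB B_ge0 hu).
- have -> : hull x s' = hull y s''.
    apply/seteqP; split; rewrite s'E.
      apply: sub_hull => // z; rewrite inE => /orP[/eqP ->|]; [exact: hull_base|exact: hull_mem].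
    apply: sub_hull => [|z zs]; apply: hull_mem; rewrite inE ?eqxx ?zs ?orbT//.
  apply: IH hx; apply: leq_trans sn; rewrite -ss' s'E /=; exact: ltnSn.
Qed.

Lemma convex_absorb A x y (k l : R) : convex_set A -> A 0 -> A x -> A y ->
  0 <= k -> 0 <= l -> k + l <= 1 -> A (k *: x + l *: y).
Proof.
move=> vA A0 Ax Ay k0 l0 kl; have [z Az ->] := convex_weighted vA k0 l0 Ax Ay.
rewrite (_ : _ *: z = (k + l) *: z + (1 - (k + l)) *: 0); last by rewrite scaler0 addr0.
by move/convex_setP : vA; apply => //; rewrite addr_ge0.
Qed.

(** The body contains [e], [f] and their opposites, hence a square around 0. Its size depends on [e]
    and [f] alone, uniformly in [P]. *)
Lemma small_in_pair_sum e f : cross e f != 0 ->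
  exists2 rho : R, 0 < rho &
    forall P, convex_set P -> P 0 -> P e -> P f ->
    forall y, `|y.1| <= rho -> `|y.2| <= rho -> pair_sum B P y.
Proof.
move=> D.
(* With this [M], the Cramer coefficients of [y] have absolute values summing to at most 1. *)
pose M := `|e.1| + `|e.2| + `|f.1| + `|f.2| + 1.
have M0 : 0 < M by rewrite ltr_wpDl// !addr_ge0.
have D0 : 0 < `|cross e f| by rewrite normr_gt0.
exists (`|cross e f| / M) => [|P vP P0 Pe Pf y y1 y2]; first by rewrite divr_gt0.
have vS : convex_set (pair_sum B P) by exact: convex_pair_sum.
have S0 : pair_sum B P 0 by exact: pair_sum_left.
have signed (k : R) x : P x -> exists2 x', pair_sum B P x' & k *: x = `|k| *: x'.
  move=> Px; have [k0|k0] := leP 0 k.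
    by exists x; [exact: pair_sum_left|rewrite ger0_norm].
  by exists (- x); [exact: pair_sum_right|rewrite ltr0_norm// scalerN scaleNr opprK].
have -> : y = (cross y f / cross e f) *: e + (cross e y / cross e f) *: f.
  by apply: eq_planeP; move: D; rewrite /cross !scale_pairE/= => D; field.
have [e' Se' ->] := signed (cross y f / cross e f) _ Pe.
have [f' Sf' ->] := signed (cross e y / cross e f) _ Pf.
apply: convex_absorb => //.
rewrite !normrM normfV -mulrDl ler_pdivrMr// mul1r.
have b1 : `|cross y f| <= `|cross e f| / M * (`|f.1| + `|f.2|).
  rewrite /cross; apply: (le_trans (ler_normB _ _)); rewrite !normrM mulrDr addrC.
  by apply: lerD; apply: ler_wpM2r.
have b2 : `|cross e y| <= `|cross e f| / M * (`|e.1| + `|e.2|).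
  rewrite {1}/cross; apply: (le_trans (ler_normB _ _)); rewrite !normrM mulrDr.
  by apply: lerD; rewrite mulrC; apply: ler_wpM2r.
apply: (le_trans (lerD b1 b2)); rewrite -mulrDr -mulrA ger_pMr//.
rewrite mulrC ler_pdivrMr// mul1r /M; lra.
Qed.

Lemma finite_net K (delta : R) : 0 < delta -> compact K ->
  exists s : seq (R * R), (forall x, x \in s -> K x) /\
    forall x, K x -> exists2 y, y \in s & `|x.1 - y.1| <= delta /\ `|x.2 - y.2| <= delta.
Proof.
move=> d0 cK; have : cover_compact K by rewrite -(@compact_cover ((R * R)%type : normedModType R)).
move=> /(_ _ K (fun x => ball x delta))[].
- by move=> x _; exact: ball_open.
- by move=> x Kx; exists x => //; exact: ballxx.
move=> S SK KS; exists (finmap.enum_fset S); split => [x xS|x /KS[y yS] [] ].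
  by have := SK x xS; rewrite inE.
rewrite -!ball_normE/= => /ltW xy1 /ltW xy2; exists y => //.
by rewrite distrC; split=> //; rewrite distrC.
Qed.

(** Replacing [x] and [y] by net points changes [k.1 *: x - k.2 *: y] by [eps *: r] with [r] in the
    small square inside [pair_sum B P]; convexity absorbs this into the factor [1 + eps]. *)
Lemma pair_sum_approx K e f (eps : R) : cross e f != 0 -> compact K ->
  K e -> K f -> 0 < eps ->
  exists2 s, (forall x, x \in s -> K x) &
    pair_sum B K `<=` (fun x => (1 + eps) *: x) @` pair_sum B (hull 0 s).
Proof.
move=> D cK Ke Kf eps0.
have [rho rho0 small] := small_in_pair_sum D.
(* Coefficients are at most 1, so two errors of this size add up to at most [eps * rho]. *)
have delta0 : 0 < eps * rho / 2 by rewrite divr_gt0// mulr_gt0.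
have [s [sK Ks]] := finite_net delta0 cK.
exists [:: e, f & s] => [x|].
  by rewrite !inE => /or3P[/eqP->|/eqP->|]//; exact: sK.
set P := hull 0 _.
have vP : convex_set P by exact: convex_hull.
have P0 : P 0 by exact: hull_base.
have smallP : forall y, `|y.1| <= rho -> `|y.2| <= rho -> pair_sum B P y.
  apply: small => //; apply: hull_mem; rewrite !inE eqxx ?orbT//.
move=> _ [k [x [y [Bk Kx Ky ->]]]].
have [x' xs [x1 x2]] := Ks _ Kx; have [y' ys [y1 y2]] := Ks _ Ky.
have [k1 k2] := B_ge0 Bk; have [k1' k2'] := B_le1 Bk.
have Sxy : pair_sum B P (k.1 *: x' - k.2 *: y').
  by exists k, x', y'; split=> //; apply: hull_mem; rewrite !inE ?xs ?ys !orbT.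
have bound (p q p' q' : R) : `|p - p'| <= eps * rho / 2 -> `|q - q'| <= eps * rho / 2 ->
    `|eps^-1 * (k.1 * (p - p') - k.2 * (q - q'))| <= rho.
  move=> pp qq; rewrite normrM gtr0_norm ?invr_gt0// mulrC ler_pdivrMr//.
  apply: (le_trans (ler_normB _ _)); rewrite !normrM (ger0_norm k1) (ger0_norm k2) [leRHS]mulrC (splitr (eps * rho)).
  by apply: lerD; rewrite -[leRHS]mul1r; apply: ler_pM.
pose r := eps^-1 *: (k.1 *: (x - x') - k.2 *: (y - y')).
have Sr : pair_sum B P r.
  by apply: smallP; rewrite /r !scale_pairE/=; apply: bound.
have vS : convex_set (pair_sum B P) by exact: convex_pair_sum.
have [z Sz ez] := convex_weighted vS (ler01 : 0 <= (1 : R)) (ltW eps0) Sxy Sr.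
exists z => //; rewrite -ez /r.
have eps_neq0 : eps != 0 by rewrite gt_eqF.
by apply: eq_planeP; rewrite !scale_pairE/=; field.
Qed.

Lemma area_pair_sum_le K : compact K -> convex_set K -> K 0 ->
  (area (pair_sum B K) <= c%:E * area K)%E.
Proof.
move=> cK vK K0.
(* If all points of [K] are parallel, [K] lies on a line through 0 and the left side vanishes. *)
have [flat|/existsNP[e /existsNP[f /not_implyP[Ke /not_implyP[Kf /eqP D]]]]] :=
    pselect (forall e f, K e -> K f -> cross e f = 0).
  have [d d0 dK] : exists2 d, d != 0 & forall x, K x -> cross d x = 0.
    have [[d [Kd /eqP d0]]|nK] := pselect (exists d, K d /\ d <> 0).
      by exists d => // x; exact: flat.
    exists (1, 0) => [|x Kx]; first by rewrite -[_ == _]/(_ && _)/= oner_eq0.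
    have -> : x = 0 by apply: contrapT => x0; apply: nK; exists x.
    by rewrite /cross/=; ring.
  rewrite (area_pair_sum_line compactB cK d0 dK) mule_ge0 ?area_ge0//.
  by rewrite lee_fin pair_sum_const_ge0.
have aK := area_compact_fin_num cK.
have aS := area_compact_fin_num (compact_pair_sum compactB cK).
rewrite -(fineK aK) -(fineK aS) -EFinM lee_fin.
set q := fine (area (pair_sum B K)); set m := c * fine (area K).
have m0 : 0 <= m by rewrite mulr_ge0 ?pair_sum_const_ge0// fine_ge0// area_ge0.
have scaled eps : 0 < eps -> q <= (1 + eps) ^+ 2 * m.
  move=> eps0; have [s sK KS] := pair_sum_approx D cK Ke Kf eps0.
  rewrite -lee_fin fineK// /m mulrA EFinM fineK// EFinM -muleA.
  have cP : compact (hull (0 : R * R) s) by exact: compact_hull.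
  have cSP : compact (pair_sum B (hull 0 s)) by exact: compact_pair_sum.
  apply: (@le_trans _ _ (((1 + eps) ^+ 2)%:E * area (pair_sum B (hull 0%R s)))%E).
    rewrite -area_scale//; last by rewrite addr_gt0.
    apply: le_area => //; apply: compact_measurable_plane.
      exact: compact_pair_sum.
    apply: continuous_image_compact => // x; apply: cvgZ; [exact: cvg_cst|exact: cvg_id].
  apply: lee_wpmul2l; first by rewrite lee_fin sqr_ge0.
  apply: (@le_trans _ _ (c%:E * area (hull 0%R s))%E).
    have := area_pair_sum_polygon (@hull_base _ 0 s).
    rewrite (_ : shift 0 _ = hull 0 s)//.
    by rewrite /shift; under eq_imagel do rewrite subr0; rewrite image_id.
  apply: lee_wpmul2l; first by rewrite lee_fin pair_sum_const_ge0.
  apply: le_area; [exact: compact_measurable_plane|exact: compact_measurable_plane|].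
  exact: hull_min.
apply/ler_addgt0Pr => eps eps0.
(* For [h <= 1], [(1 + h) ^+ 2 * m <= m + 3 * h * m], and the second bound on [h] makes this at most
   [m + eps]. *)
pose h := Num.min 1 (eps / (3 * m + 1)).
have d0 : 0 < 3 * m + 1 by lra.
have h0 : 0 < h by rewrite lt_min ltr01 divr_gt0.
have h1 : h <= 1 by rewrite ge_min lexx.
have h2 : h * (3 * m + 1) <= eps by rewrite -ler_pdivlMr// ge_min lexx orbT.
have := scaled h h0; nra.
Qed.

End PairSumGeneral.

(** * The p-difference body *)

Section PSum.
Variable R : realType.
Implicit Types (K L M A : set (R * R)) (x y z w d u : R * R).
Variable p : R.
Hypothesis hp : 1 <= p.

Let p_gt0 : 0 < p. Proof. exact: lt_le_trans ltr01 hp. Qed.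
Let p_neq0 : p != 0. Proof. by rewrite gt_eqF. Qed.

Definition lp_norm (s t : R) : R := (s `^ p + t `^ p) `^ p^-1.

(* The nonnegative part of the unit ball of the dual norm, given by the
   inequalities that define duality, so that the conjugate exponent does not
   appear and [p = 1] is not a special case. *)
Definition dual_ball : set (R * R) :=
  [set c | [/\ 0 <= c.1, 0 <= c.2 &
    forall s t, 0 <= s -> 0 <= t -> c.1 * s + c.2 * t <= lp_norm s t]].

Lemma powRpV (s : R) : 0 <= s -> (s `^ p) `^ p^-1 = s.
Proof. by move=> s0; rewrite -powRrM divff// powRr1. Qed.

Lemma powRVp (s : R) : 0 <= s -> (s `^ p^-1) `^ p = s.
Proof. by move=> s0; rewrite -powRrM mulVf// powRr1. Qed.

Lemma lp_norm_ge_left (s t : R) : 0 <= s -> s <= lp_norm s t.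
Proof.
move=> s0; rewrite -[leLHS]powRpV//; apply: ge0_ler_powR.
- by rewrite invr_ge0 ltW.
- by rewrite nnegrE powR_ge0.
- by rewrite nnegrE addr_ge0// powR_ge0.
- by rewrite lerDl powR_ge0.
Qed.

Lemma lp_normC (s t : R) : lp_norm s t = lp_norm t s.
Proof. by rewrite /lp_norm addrC. Qed.

Lemma lp_norms0 (s : R) : 0 <= s -> lp_norm s 0 = s.
Proof. by move=> s0; rewrite /lp_norm powR0// addr0 powRpV. Qed.

Lemma dual_ball_ge0 c : dual_ball c -> 0 <= c.1 /\ 0 <= c.2.
Proof. by case. Qed.

Lemma dual_ball_le1 c : dual_ball c -> c.1 <= 1 /\ c.2 <= 1.
Proof.
move=> [c1 c2 H]; split.
  by have := H 1 0 ler01 (lexx 0); rewrite lp_norms0 ?ler01// mulr0 mulr1 addr0.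
by have := H 0 1 (lexx 0) ler01; rewrite lp_normC lp_norms0 ?ler01// mulr0 mulr1 add0r.
Qed.

Lemma dual_ball10 : dual_ball (1, 0).
Proof.
by split=> //= s t s0 t0; rewrite mul1r mul0r addr0; exact: lp_norm_ge_left.
Qed.

Lemma dual_ball01 : dual_ball (0, 1).
Proof.
by split=> //= s t s0 t0; rewrite mul1r mul0r add0r lp_normC; exact: lp_norm_ge_left.
Qed.

Lemma convex_dual_ball : convex_set dual_ball.
Proof.
apply/convex_setP => c c' k k0 k1 [c1 c2 H] [c1' c2' H'].
have l0 : 0 <= 1 - k by rewrite subr_ge0.
rewrite !scale_pairE; split=> [/=|/=|s t s0 t0 /=].
- by rewrite addr_ge0// mulr_ge0.
- by rewrite addr_ge0// mulr_ge0.
- have -> : lp_norm s t = k * lp_norm s t + (1 - k) * lp_norm s t by ring.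
  apply: le_trans (lerD (ler_wpM2l k0 (H s t s0 t0)) (ler_wpM2l l0 (H' s t s0 t0))).
  by rewrite le_eqVlt; apply/orP; left; apply/eqP; ring.
Qed.

Lemma closed_le_affine_form (a b e : R) : closed [set c : R * R | a * c.1 + b * c.2 <= e].
Proof.
have cc := @continuous_affine_form R a b 0.
have := @closed_comp _ _ _ [set r | r <= e] (fun c _ => cc c) (@closed_le _ e).
by congr closed; apply/seteqP; split => c /=; rewrite addr0.
Qed.

Lemma compact_dual_ball : compact dual_ball.
Proof.
have -> : dual_ball = ((`[0, 1]%classic `*` `[0, 1]%classic) `&`
    \bigcap_(st in [set st : R * R | 0 <= st.1 /\ 0 <= st.2])
      [set c | st.1 * c.1 + st.2 * c.2 <= lp_norm st.1 st.2])%R.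
  apply/seteqP; split=> c.
    move=> Bc; have [c1 c2] := dual_ball_le1 Bc; case: Bc => c10 c20 H.
    split; first by split; rewrite /= in_itv/=; apply/andP.
    by move=> [s t] [s0 t0] /=; rewrite mulrC [t * _]mulrC; exact: H.
  move=> [[]]; rewrite /= !in_itv/= => /andP[c10 _] /andP[c20 _] H.
  by split=> // s t s0 t0; have := H (s, t) (conj s0 t0); rewrite /= mulrC [t * _]mulrC.
apply: compact_closedI; first by apply: compact_setX; exact: segment_compact.
by apply: closed_bigI => st _; exact: closed_le_affine_form.
Qed.

(** The equality case of Hölder's inequality, with [p = 1] and zero norm treated apart. *)
Lemma dual_ball_attains (s t : R) : 0 <= s -> 0 <= t ->
  exists2 c, dual_ball c & c.1 * s + c.2 * t = lp_norm s t.
Proof.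
move=> s0 t0; have [p1|p1] := eqVneq p 1.
  have normE a b : 0 <= a -> 0 <= b -> lp_norm a b = a + b.
    by move=> a0 b0; rewrite /lp_norm p1 invr1 !powRr1// addr_ge0.
  exists (1, 1); last by rewrite normE//= !mul1r.
  by split=> //= a b a0 b0; rewrite normE// !mul1r.
pose N := lp_norm s t.
have N0 : 0 <= N by exact: powR_ge0.
have [NE|NE] := eqVneq N 0.
  exists (1, 0); first exact: dual_ball10.
  rewrite -/N NE mul1r mul0r addr0; apply/eqP; rewrite eq_le s0 -NE andbT.
  exact: lp_norm_ge_left.
have N_gt0 : 0 < N by rewrite lt_neqAle eq_sym NE.
have p1_gt0 : 0 < p - 1 by rewrite subr_gt0 lt_neqAle eq_sym p1.
pose q := p / (p - 1).
have q_gt0 : 0 < q by rewrite divr_gt0.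
have pq : p^-1 + q^-1 = 1.
  by rewrite /q; field; rewrite p_neq0 gt_eqF.
have sN : 0 <= s / N by rewrite divr_ge0.
have tN : 0 <= t / N by rewrite divr_ge0.
have sum1 : (s / N) `^ p + (t / N) `^ p = 1.
  rewrite !powRM ?invr_ge0// -mulrDl -powR_inv1// -powRAC powR_inv1 ?powR_ge0//.
  by rewrite /N /lp_norm powRVp ?addr_ge0 ?powR_ge0// divff// -(powRVp (addr_ge0 (powR_ge0 _ _) (powR_ge0 _ _))) -/(lp_norm s t) -/N powR_eq0 (negbTE NE).
have conj_pow a : (a `^ (p - 1)) `^ q = a `^ p.
  by rewrite -powRrM /q mulrC divfK// gt_eqF.
(* This vector has [q]-norm 1, since the [q]-th powers of its entries are [(s / N) ^ p] and
   [(t / N) ^ p]. *)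
exists ((s / N) `^ (p - 1), (t / N) `^ (p - 1)).
  split=> [/=|/=|a b a0 b0 /=]; try exact: powR_ge0.
  have := @hoelder2 _ a b _ _ _ _ a0 b0 (powR_ge0 (s / N) (p - 1)) (powR_ge0 (t / N) (p - 1)) p_gt0 q_gt0 pq.
  by rewrite !conj_pow sum1 powR1 mulr1 [a * _]mulrC [b * _]mulrC.
rewrite -/N; transitivity (N * ((s / N) `^ p + (t / N) `^ p)); last by rewrite sum1 mulr1.
rewrite -(mulr_powRB1 sN p_gt0) -(mulr_powRB1 tN p_gt0) /=.
by field.
Qed.

Lemma support_fun_attained K u : K !=set0 -> compact K ->
  exists2 x, K x & support_fun K u = dot x u /\ forall y, K y -> dot y u <= dot x u.
Proof.
move=> K0 cK.
have cd : {within K, continuous (fun x => dot x u)}.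
  apply: continuous_subspaceT.
  rewrite (_ : (fun x => dot x u) = fun x => u.1 * x.1 + u.2 * x.2 + 0); first exact: continuous_affine_form.
  by apply/funext => x; rewrite /dot addr0 mulrC [u.2 * _]mulrC.
have [x] := compact_EVT_max K0 cK cd; rewrite inE => Kx xmax.
have Kmax y : K y -> dot y u <= dot x u by move=> Ky; apply: xmax; rewrite inE.
exists x => //; split=> //; apply/eqP; rewrite eq_le; apply/andP; split.
  by apply: ge_sup => [|_ [y Ky <-]]; [exists (dot x u); exists x|exact: Kmax].
by apply: ub_le_sup; [exists (dot x u) => _ [y Ky <-]; exact: Kmax|exists x].
Qed.

(** A point of [K] outside [L] is strictly separated from [L]. The normal [u] points towards [L], so
    the support functions are compared at [- u]. *)
Lemma support_fun_le_sub K L : convex_body K -> convex_body L ->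
  (forall u, support_fun K u <= support_fun L u) -> K `<=` L.
Proof.
move=> [K0 cK vK] [L0 cL vL] KL z Kz; apply: contrapT => Lz.
have [||||u hu] := @separation0 _ (shift z L).
- exact: compact_shift.
- exact: convex_shift.
- by have [y Ly] := L0; exists (y - z); exists y.
- by move=> [y Ly /eqP]; rewrite subr_eq0 => /eqP yz; apply: Lz; rewrite -yz.
have [x Kx [hK xmax]] := support_fun_attained (- u) K0 cK.
have [y Ly [hL _]] := support_fun_attained (- u) L0 cL.
have := KL (- u); rewrite hK hL => xy.
have zx := xmax z Kz.
have : 0 < dot u (y - z) by apply: hu; exists y.
move: xy zx; rewrite /dot/=; lra.
Qed.

Lemma support_fun_ge0 K u : convex_body K -> K 0 -> 0 <= support_fun K u.
Proof.
move=> [K0 cK _] K00; have [x Kx [-> xmax]] := support_fun_attained u K0 cK.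
by apply: le_trans (xmax 0 K00); rewrite /dot/= !mul0r addr0.
Qed.

Lemma convex_body_reflection K : convex_body K -> convex_body (reflection K).
Proof.
move=> [[x Kx] cK vK]; split; first by exists (- x); exists x.
  by apply: continuous_image_compact => //; exact: opp_continuous.
apply/convex_setP => _ _ t t0 t1 [y Ky <-] [z Kz <-].
exists (t *: y + (1 - t) *: z); first by move/convex_setP : vK; apply.
by rewrite !scalerN opprD.
Qed.

Lemma convex_body_pair_sum K : convex_body K -> K 0 -> convex_body (pair_sum dual_ball K).
Proof.
move=> [_ cK vK] K0; split.
- by exists 0; apply: pair_sum_left => //; exact: dual_ball10.
- by apply: compact_pair_sum => //; exact: compact_dual_ball.
- by apply: convex_pair_sum => //; [exact: convex_dual_ball|exact: dual_ball_ge0].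
Qed.

(** Maximizing over [x] and [y] gives the two support values, nonnegative because 0 is in [K];
    maximizing over [c] gives their [lp_norm] by duality. *)
Lemma support_fun_pair_sum K u : convex_body K -> K 0 ->
  support_fun (pair_sum dual_ball K) u =
  lp_norm (support_fun K u) (support_fun (reflection K) u).
Proof.
move=> bK K0; have [neK cK vK] := bK.
have bK' := convex_body_reflection bK; have [neK' cK' vK'] := bK'.
have K'0 : reflection K 0 by exists 0; rewrite ?oppr0.
have h0 := support_fun_ge0 u bK K0; have k0 := support_fun_ge0 u bK' K'0.
have [neS cS _] := convex_body_pair_sum bK K0.
have [z Sz [-> zmax]] := support_fun_attained u neS cS.
have [x Kx [hx xmax]] := support_fun_attained u neK cK.
have [_ [y Ky <-] [ky ymax]] := support_fun_attained u neK' cK'.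
rewrite hx ky in h0 k0 *.
have dotE (c : R * R) (a b : R * R) : dot (c.1 *: a - c.2 *: b) u = c.1 * dot a u + c.2 * dot (- b) u.
  by rewrite /dot !scale_pairE/=; ring.
apply/eqP; rewrite eq_le; apply/andP; split.
  move: Sz => [c [a [b [[c1 c2 Bc] Ka Kb ->]]]]; rewrite dotE.
  apply: le_trans (Bc _ _ h0 k0); apply: lerD; apply: ler_wpM2l => //; first exact: xmax.
  by apply: ymax; exists b.
have [c Bc <-] := dual_ball_attains h0 k0; rewrite -dotE.
by apply: zmax; exists c, x, y.
Qed.

(** Support functions determine convex bodies, so [xget] can only return this body and its default
    is not reached. *)
Lemma psum_reflectionE K : convex_body K -> K 0 ->
  psum p K (reflection K) = pair_sum dual_ball K.
Proof.
move=> bK K0; apply: xget_unique.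
  by split; [exact: convex_body_pair_sum|move=> u; exact: support_fun_pair_sum].
move=> M [bM hM]; have bS := convex_body_pair_sum bK K0.
by apply/seteqP; split; apply: support_fun_le_sub => // u; rewrite hM support_fun_pair_sum.
Qed.

End PSum.

(** * Triangles at the origin and the final inequality *)

Lemma affinely_independent3_cross (R : realType) (a b : R * R) :
  affinely_independent3 0 a b -> cross a b != 0.
Proof.
move=> ind; apply/eqP => D.
(* If the cross product vanishes, these two linear relations force [a = b = 0], and then
   [1 *: a + 0 *: b = 0] contradicts independence. *)
have [] := ind b.1 (- a.1).
  by rewrite !subr0; apply: eq_planeP; move: D; rewrite /cross !scale_pairE/=; lra.
have [] := ind b.2 (- a.2).
  by rewrite !subr0; apply: eq_planeP; move: D; rewrite /cross !scale_pairE/=; lra.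
move=> b2 /eqP; rewrite oppr_eq0 => /eqP a2 b1 /eqP; rewrite oppr_eq0 => /eqP a1.
have [] := ind 1 0.
  by rewrite !subr0; apply: eq_planeP; rewrite !scale_pairE/= ?a1 ?a2; ring.
by move=> /eqP; rewrite oner_eq0.
Qed.

Lemma triangle_hull (R : realType) (a b : R * R) : triangle 0 a b = hull 0 [:: a; b].
Proof.
apply/seteqP; split=> [_ [r [s [t [r0 s0 t0 rst ->]]]]|].
  have vH := @convex_hull R 0 [:: a; b].
  rewrite scaler0 add0r; apply: convex_absorb => //.
  - exact: hull_base.
  - by apply: hull_mem; rewrite mem_head.
  - by apply: hull_mem; rewrite !inE eqxx orbT.
  - lra.
apply: hull_min => [||x].
- apply/convex_setP => _ _ k k0 k1 [r [s [t [r0 s0 t0 rst ->]]]] [r' [s' [t' [r'0 s'0 t'0 rst' ->]]]].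
  have l0 : 0 <= 1 - k by rewrite subr_ge0.
  exists (k * r + (1 - k) * r'), (k * s + (1 - k) * s'), (k * t + (1 - k) * t').
  split; try by rewrite addr_ge0// mulr_ge0.
    transitivity (k * (r + s + t) + (1 - k) * (r' + s' + t')); first by ring.
    by rewrite rst rst'; ring.
  by apply: eq_planeP; rewrite !scale_pairE/=; ring.
- by exists 1, 0, 0; split=> //; rewrite ?addr0// !scale0r scaler0 !addr0.
- rewrite !inE => /orP[]/eqP ->.
    by exists 0, 1, 0; split=> //; rewrite ?addr0 ?add0r// scale1r !scale0r addr0 add0r.
  by exists 0, 0, 1; split=> //; rewrite ?addr0 ?add0r// scale1r !scale0r !add0r.
Qed.

Theorem theorem1p1 (R : realType) (p : R) (hp : 1 <= p) :
  exists c : R,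
    (forall K : set (R * R), convex_body K -> K 0 ->
       (area (psum p K (reflection K)) <= c%:E * area K)%E) /\
    (forall K : set (R * R), triangle_at_origin K ->
       area (psum p K (reflection K)) = (c%:E * area K)%E).
Proof.
have cB := compact_dual_ball hp; have vB := @convex_dual_ball R p.
have B0 := @dual_ball_ge0 R p; have B1 := @dual_ball_le1 R p hp.
exists (pair_sum_const (dual_ball p)); split=> [K bK K0|_ [a [b [/affinely_independent3_cross D ->]]]].
  rewrite psum_reflectionE//; have [_ cK vK] := bK.
  exact: (area_pair_sum_le cB vB B0 B1 (dual_ball10 hp) (dual_ball01 hp)).
have H0 : hull 0 [:: a; b] 0 by exact: hull_base.
rewrite triangle_hull psum_reflectionE//; last first.
  by split; [exists 0|exact: compact_hull|exact: convex_hull].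
(* Both areas carry the same factor, the absolute value of [cross a b], so the ratio is that of the
   unit triangle. *)
rewrite (area_pair_sum_triangle cB D) (area_triangle D).
rewrite area_unit_triangleE (area_pair_sum_unit_triangleE cB) -!EFinM; congr EFin.
by rewrite /pair_sum_const mulrCA divfK// gt_eqF// fine_area_unit_triangle_gt0.
Qed.
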